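(* Let $d\ge1$, $n\ge2$ be integers, $\alpha>0$, $(\gamma,\beta)\in(0,1)^2$, and let $p^0=(p^0_0,\dots,p^0_{d-1})$ be a given probability vector. Let $\widetilde X_1,\dots,\widetilde X_n$ be i.i.d. with values in $\{0,1,\dots,d-1\}$ and common distribution given by the probability vector $p=(p_0,\dots,p_{d-1})$. From the private views $Z_1,\dots,Z_n$ (defined in the context, with $L=d$ and parameter $\alpha$), consider the test $\Delta_{d,\gamma,Q}$ of $H_0:p=p^0$ against $H_1:p\ne p^0$, which has a first kind error of $\gamma$. There is a constant $C(\gamma,\beta)$ depending only on $\gamma,\beta$ such that the second kind error of the test is controlled by $\beta$, i.e. $\mathbb P_{Q^n_f}(\Delta_{d,\gamma,Q}(Z_1,\dots,Z_n)=0)\le\beta$, provided that $$\sqrt{\sum_{i=0}^{d-1}(p_i-p^0_i)^2}\ \ge\ C(\gamma,\beta)\,\frac{d^{-1/4}}{n^{1/2}}\left(d^{1/4}\left[\Big(\sum_{k=0}^{d-1}(p^0_k)^2\Big)^{1/4}+n^{-1/2}\right]+d^{1/2}\alpha^{-1}\right).$$ In particular (since $\sum_{k}(p^0_k)^2\le1$), there is a constant $C(\gamma,\beta)$ depending only on $\gamma,\beta$ such that the second kind error of the test is controlled by $\beta$ provided that $$\sqrt{\sum_{i=0}^{d-1}(p_i-p^0_i)^2}\ \ge\ C(\gamma,\beta)\,n^{-1/2}\left(1\vee\left[d^{1/4}\alpha^{-1}\right]\right).$$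
   Context: Notation: $a\vee b=\max(a,b)$. Passage to continuous data. If $\widetilde X_i=k$, then $X_i$ is drawn uniformly on $[k/d,(k+1)/d)$ (independently over $i$). The $X_i$ are i.i.d. with density $f=d\sum_{k=0}^{d-1}p_k\mathbf 1_{[k/d,(k+1)/d)}$, and to $p^0$ is associated $f_0=d\sum_{k=0}^{d-1}p^0_k\mathbf 1_{[k/d,(k+1)/d)}$; thus $p=p^0\iff f=f_0$. Laplace channel. For an integer $L\ge1$ and $k\in\{0,\dots,L-1\}$ let $\varphi_{L,k}(x)=\sqrt L\,\mathbf 1_{[0,1)}(Lx-k)$. The private views are $Z_i=(Z_{i,L,k})_{0\le k\le L-1}$ with $$Z_{i,L,k}=\varphi_{L,k}(X_i)+\sigma_L W_{i,L,k},\qquad \sigma_L=2\sqrt2\,\frac{\sqrt L}{\alpha},$$ where the $W_{i,L,k}$ are i.i.d. Laplace random variables, centered with variance $1$, independent of $(X_1,\dots,X_n)$. Here $L=d$. $Q$ denotes this channel and $\mathbb P_{Q^n_f}$ the law of $(Z_1,\dots,Z_n)$ when the $X_i$ have density $f$. Test. With $\alpha^0_{L,k}=\int_0^1\varphi_{L,k}(x)f_0(x)\,dx$, $$\hat T_L=\frac1{n(n-1)}\sum_{i\ne l=1}^n\sum_{k=0}^{L-1}(Z_{i,L,k}-\alpha^0_{L,k})(Z_{l,L,k}-\alpha^0_{L,k}),\qquad \Delta_{L,\gamma,Q}(Z_1,\dots,Z_n)=\mathbf 1_{\hat T_L>t^0_L(1-\gamma)},$$ where $t^0_L(1-\gamma)$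 is the $(1-\gamma)$-quantile of $\hat T_L$ under $\mathbb P_{Q^n_{f_0}}$. *)

(* Defs.v *)
From HB Require Import structures.
From mathcomp Require Import all_boot all_order all_algebra.
From mathcomp Require Import all_classical all_reals all_analysis.
From mathcomp Require Import measurable_realfun.

Set Implicit Arguments.
Unset Strict Implicit.
Unset Printing Implicit Defensive.

Import Order.TTheory GRing.Theory Num.Theory.
Import numFieldNormedType.Exports.

Local Open Scope classical_set_scope.
Local Open Scope ring_scope.

Record pvec (R : realType) (d : nat) := Pvec {
  pmass :> 'I_d -> R;
  pmass_ge0 : forall k, 0 <= pmass k;
  pmass_sum1 : \sum_(k < d) pmass k = 1 }.

(* If [Xt] has law [p] and, given [Xt = k], [X] has law [mu k], then
   [mixture p mu] is the law of [X]. *)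
Section mixture.
Context d0 (T : measurableType d0) (R : realType) (d : nat).
Variables (p : pvec R d) (mu : 'I_d -> probability T R).
Local Open Scope ereal_scope.

Definition mixture (A : set T) : \bar R := \sum_(k < d) (p k)%:E * mu k A.

Let mixture0 : mixture set0 = 0.
Proof. by rewrite /mixture big1// => k _; rewrite measure0 mule0. Qed.

Let mixture_ge0 A : 0 <= mixture A.
Proof.
by apply: sume_ge0 => k _; rewrite mule_ge0// lee_fin pmass_ge0.
Qed.

Let mixture_sigma_additive : semi_sigma_additive mixture.
Proof.
move=> F mF tF mUF.
pose m (k : 'I_d) : {measure set T -> \bar R} :=
  mscale (NngNum (pmass_ge0 p k)) (mu k).
rewrite [X in _ --> X](_ : _ =
    lim ((fun n => \sum_(0 <= i < n) mixture (F i)) @ \oo)).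
  by apply: is_cvg_ereal_nneg_natsum => k _; exact: mixture_ge0.
rewrite nneseries_sum; last by move=> i j _; exact: (measure_ge0 (m i)).
by apply: eq_bigr => /= i _; exact: (measure_semi_bigcup (m i)).
Qed.

HB.instance Definition _ := isMeasure.Build _ _ _ mixture
  mixture0 mixture_ge0 mixture_sigma_additive.

Let mixture_setT : mixture [set: T] = 1.
Proof.
rewrite /mixture -(pmass_sum1 p) -sumEFin.
by apply: eq_bigr => k _; rewrite probability_setT mule1.
Qed.

HB.instance Definition _ := Measure_isProbability.Build _ _ _
  mixture mixture_setT.

End mixture.

(* Law of [n] independent draws from [P]. *)
Section iid.
Context d0 (T : measurableType d0) (R : realType).

Definition tuple_cons n (x : T * n.-tuple T) : n.+1.-tuple T :=
  [tuple of x.1 :: x.2].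

Lemma measurable_tuple_cons n : measurable_fun [set: _] (@tuple_cons n).
Proof. by apply: measurable_cons. Qed.

HB.instance Definition _ n :=
  isMeasurableFun.Build _ _ _ _ (@tuple_cons n) (@measurable_tuple_cons n).

Fixpoint iid (P : probability T R) (n : nat) : probability (n.-tuple T) R :=
  match n with
  | 0 => \d_([tuple] : 0.-tuple T)
  | n'.+1 => distribution (P \x iid P n')%E (@tuple_cons n')
  end.

End iid.

(* Centered Laplace law with scale [b = 1 / sqrt 2], i.e. variance [2 b^2 = 1]. *)
Section laplace.
Context {R : realType}.
Notation mu := (@lebesgue_measure R).

Definition laplace_pdf (x : R) : R :=
  (Num.sqrt 2)^-1 * expR (- Num.sqrt 2 * `|x|).

Lemma laplace_pdf_ge0 x : 0 <= laplace_pdf x.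
Proof. by rewrite mulr_ge0 ?invr_ge0 ?sqrtr_ge0 ?expR_ge0. Qed.

Lemma continuous_laplace_pdf : continuous laplace_pdf.
Proof.
move=> x; apply: cvgM; first exact: cvg_cst.
apply: (@cvg_comp _ _ _ (fun x : R => - Num.sqrt 2 * `|x|) expR
  _ _ _ _ (@continuous_expR R _)).
apply: cvgM; first exact: cvg_cst.
exact: (@norm_continuous _ R^o).
Qed.

Lemma measurable_laplace_pdf : measurable_fun [set: R] laplace_pdf.
Proof. by apply: continuous_measurable_fun; exact: continuous_laplace_pdf. Qed.

Lemma integral_laplace_pdf : (\int[mu]_x (laplace_pdf x)%:E = 1)%E.
Proof.
have s0 : 0 < Num.sqrt 2 :> R by rewrite sqrtr_gt0.
have s2 : Num.sqrt 2 * Num.sqrt 2 = 2 :> R by rewrite -expr2 sqr_sqrtr.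
have sV : (Num.sqrt 2)^-1 = 2^-1 * Num.sqrt 2 :> R.
  by rewrite -{2}s2 invfM mulfVK// gt_eqF.
have -> := ge0_symfun_integralT laplace_pdf_ge0 continuous_laplace_pdf
  (fun x => congr1 (fun y => _ * expR (_ * y)) (esym (normrN x))).
have -> : (\int[mu]_(x in [set x | (0 <= x)%R]) (laplace_pdf x)%:E =
    2^-1%:E * \int[mu]_x (exponential_pdf (Num.sqrt 2) x)%:E)%E.
  rewrite integral_mkcond -ge0_integralZl//=; last 2 first.
  - by apply/measurable_EFinP; exact: measurable_exponential_pdf.
  - by move=> x _; rewrite lee_fin exponential_pdf_ge0// ltW.
  apply: eq_integral => x _; rewrite patchE -EFinM.
  case: ifPn => [|]; first rewrite inE/= => x0.
    by rewrite exponential_pdfE// /laplace_pdf ger0_norm// sV mulrA.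
  by rewrite notin_setE/= => /negP; rewrite -ltNge => x0;
    rewrite lt0_exponential_pdf// mulr0.
by rewrite integral_exponential_pdf// mule1 -EFinM mulfV.
Qed.

Definition laplace (A : set (measurableTypeR R)) : \bar R :=
  (\int[mu]_(x in A) (laplace_pdf x)%:E)%E.

Let laplace0 : laplace set0 = 0%E.
Proof. by rewrite /laplace integral_set0. Qed.

Let laplace_ge0 A : (0 <= laplace A)%E.
Proof. by apply: integral_ge0 => x _; rewrite lee_fin laplace_pdf_ge0. Qed.

Let laplace_sigma_additive : semi_sigma_additive laplace.
Proof.
move=> /= F mF tF mUF; rewrite /laplace; apply: cvg_toP.
  apply: ereal_nondecreasing_is_cvgn => m n mn.
  apply: lee_sum_nneg_natr => // k _ _; apply: integral_ge0 => /= x Fkx.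
  by rewrite lee_fin laplace_pdf_ge0.
rewrite ge0_integral_bigcup//=.
- by apply/measurable_funTS/measurable_EFinP; exact: measurable_laplace_pdf.
- by move=> x _; rewrite lee_fin laplace_pdf_ge0.
Qed.

HB.instance Definition _ := isMeasure.Build _ _ _ laplace
  laplace0 laplace_ge0 laplace_sigma_additive.

HB.instance Definition _ := Measure_isProbability.Build _ _ _
  laplace integral_laplace_pdf.

End laplace.

Section data.
Context {R : realType} (d : nat).

Lemma cell_lt (k : 'I_d) : k%:R / d%:R < k.+1%:R / d%:R :> R.
Proof.
rewrite ltr_pM2r ?invr_gt0 ?ltr0n ?ltr_nat//.
exact: leq_ltn_trans (ltn_ord k).
Qed.

(* The library's uniform law lives on the closed interval; it coincides with
   the one on [[k/d, (k+1)/d)] since the endpoint is Lebesgue-null. *)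
Definition cell_prob (k : 'I_d) : probability (measurableTypeR R) R :=
  uniform_prob (cell_lt k).

Definition data_law (p : pvec R d) : probability (measurableTypeR R) R :=
  mixture p cell_prob.

Definition data_density (p : pvec R d) (x : R) : R :=
  d%:R * \sum_(k < d) p k * \1_(`[k%:R / d%:R, k.+1%:R / d%:R[) x.

Lemma data_lawE (p : pvec R d) (A : set (measurableTypeR R)) : measurable A ->
  data_law p A = (\int[lebesgue_measure]_(x in A) (data_density p x)%:E)%E.
Proof.
move=> mA.
pose g (k : 'I_d) (x : measurableTypeR R) : R :=
  d%:R * \1_(`[k%:R / d%:R, k.+1%:R / d%:R[) x.
have mg k : measurable_fun A (EFin \o g k).
  apply/measurable_EFinP/measurable_funTS; apply: measurable_funM => //.
have g0 k x : 0 <= g k x by rewrite mulr_ge0// indicE.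
have cE k : cell_prob k A = (\int[lebesgue_measure]_(x in A) (g k x)%:E)%E.
  rewrite /cell_prob/= /uniform_prob; apply: ge0_ae_eq_integral => //.
  - by apply/measurable_EFinP/measurable_funTS; exact: measurable_uniform_pdf.
  - exact: mg.
  - by move=> x _; rewrite lee_fin uniform_pdf_ge0// cell_lt.
  - by move=> x _; rewrite lee_fin.
  exists [set k.+1%:R / d%:R]; split => //=; first exact: lebesgue_measure_set1.
  move=> x /=; apply: contra_notP => xk _.
  have d0 : d%:R != 0 :> R.
    by rewrite pnatr_eq0 -lt0n (leq_ltn_trans _ (ltn_ord k)).
  congr (_%:E); rewrite /uniform_pdf /g indicE -mulrBl.
  have -> : k.+1%:R - k%:R = 1 :> R by rewrite -natrB// subSnn.
  rewrite mul1r invrK mem_setE in_itv/= [in RHS]lt_neqAle.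
  have -> /= : x != k.+1%:R / d%:R by apply/eqP.
  by case: ifPn; rewrite ?mulr1 ?mulr0.
have sE k : ((p k)%:E * cell_prob k A =
    \int[lebesgue_measure]_(x in A) ((p k)%:E * (g k x)%:E))%E.
  rewrite cE ge0_integralZl//; last by rewrite lee_fin pmass_ge0.
  - exact: mg.
  - by move=> x _; rewrite lee_fin.
rewrite /data_law /= /mixture (eq_bigr _ (fun k _ => sE k)).
rewrite -ge0_integral_sum//.
- apply: eq_integral => x _; rewrite sumEFin; congr (_%:E).
  by rewrite /data_density mulr_sumr; apply: eq_bigr => k _; rewrite /g mulrCA.
- by move=> k; apply: measurable_funeM; exact: mg.
- by move=> k x _; rewrite mule_ge0// lee_fin ?pmass_ge0.
Qed.

End data.

(* One private view with [L] coordinates. *)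
Notation obs R L := (L.-tuple (measurableTypeR R)).

Section channel.
Context {R : realType} (L : nat).

Definition phi (k : 'I_L) (x : R) : R :=
  Num.sqrt L%:R * \1_(`[0, 1[) (L%:R * x - k%:R).

Definition noise_scale (alpha : R) : R :=
  2 * Num.sqrt 2 * (Num.sqrt L%:R / alpha).

Definition view (alpha : R)
    (xw : measurableTypeR R * obs R L) : obs R L :=
  [tuple phi k xw.1 + noise_scale alpha * tnth xw.2 k | k < L].

Lemma measurable_phi k : measurable_fun [set: R] (phi k).
Proof.
apply: measurable_funM => //.
apply: (measurableT_comp (measurable_indic _)); first exact: measurable_itv.
by apply: measurable_funB => //; apply: measurable_funM.
Qed.

Lemma measurable_view alpha : measurable_fun [set: _] (view alpha).
Proof.
apply/measurable_fun_tnthP => k.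
rewrite (_ : _ \o _ = fun xw : measurableTypeR R * obs R L =>
    phi k xw.1 + noise_scale alpha * tnth xw.2 k); last first.
  by apply/funext => xw /=; rewrite tnth_mktuple.
apply: measurable_funD.
  exact: measurableT_comp (measurable_phi k) measurable_fst.
apply: measurable_funM => //.
exact: measurableT_comp (measurable_tnth k) measurable_snd.
Qed.

HB.instance Definition _ alpha :=
  isMeasurableFun.Build _ _ _ _ (view alpha) (measurable_view alpha).

End channel.

Section private_law.
Context {R : realType} (d : nat) (alpha : R) (p : pvec R d).

(* Law of one [Z_i]; the [Z_i] are i.i.d. since the pairs (data, noise) are. *)
Definition view_law : probability (obs R d) R :=
  distribution (data_law p \x iid laplace d)%E (view alpha).

Definition private_law (n : nat) : probability (n.-tuple (obs R d)) R :=
  iid view_law n.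

End private_law.

(* Generalized inverse of the cdf. *)
Definition quantile d0 (T : measurableType d0) (R : realType)
    (P : probability T R) (X : {RV P >-> R}) (u : R) : R :=
  inf [set t | (u%:E <= cdf X t)%E].

Section test.
Context {R : realType} (d n : nat) (alpha gamma : R) (p0 : pvec R d).

Definition alpha0 (k : 'I_d) : R :=
  \int[lebesgue_measure]_(x in `[0, 1]) (phi k x * data_density p0 x).

Definition That (z : n.-tuple (obs R d)) : R :=
  (n%:R * (n%:R - 1))^-1 *
  \sum_(i < n) \sum_(l < n | i != l) \sum_(k < d)
    (tnth (tnth z i) k - alpha0 k) * (tnth (tnth z l) k - alpha0 k).

Lemma measurable_That : measurable_fun [set: _] That.
Proof.
have mz (i : 'I_n) (k : 'I_d) :
  measurable_fun [set: n.-tuple (obs R d)]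
    (fun z => tnth (tnth z i) k : R).
  exact: measurableT_comp (measurable_tnth k) (measurable_tnth i).
apply: measurable_funM => //.
apply: measurable_sum => i.
under eq_fun do rewrite big_mkcond.
apply: measurable_sum => l; case: (i != l) => //.
apply: measurable_sum => k.
by apply: measurable_funM; apply: measurable_funB; rewrite //; exact: mz.
Qed.

HB.instance Definition _ := isMeasurableFun.Build _ _ _ _ That measurable_That.

Definition threshold : R :=
  quantile (That : {RV private_law alpha p0 n >-> R}) (1 - gamma).

(* [true] means that the null hypothesis is rejected. *)
Definition Delta (z : n.-tuple (obs R d)) : bool := threshold < That z.

End test.

(* Main.v *)
Require Import Defs.
From mathcomp Require Import all_boot all_order all_algebra.
From mathcomp Require Import all_classical all_reals all_analysis.
From mathcomp Require Import measurable_realfun ring lra.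

Set Implicit Arguments.
Unset Strict Implicit.
Unset Printing Implicit Defensive.

Import Order.TTheory GRing.Theory Num.Theory.

Local Open Scope classical_set_scope.
Local Open Scope ring_scope.

(** Why the theorem holds.  After centering by [alpha0], the statistic is the
    U-statistic [1/(n(n-1))] times the sum over [i <> l] of the scalar products
    [<Z_i - alpha0, Z_l - alpha0>].

    Level.  The threshold is the [(1 - gamma)]-quantile, so the level is exactly
    [gamma] as soon as the null law of the statistic has no atom.  Given the
    views 2 to n, the statistic is an affine function of the first view, and the
    coefficients of its linear part are proportional to the coordinates of the
    centered sum of the other views.  The Laplace noise makes every
    non-degenerate hyperplane negligible for a view ([view_hyperplane]); used a
    first time this shows that the linear part is almost surely nonzero, used a
    second time that the statistic avoids any given value ([That_no_atom]).

    Power.  Write [delta] for the Euclidean distance of [p] and [p0], [N] for the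
    Euclidean norm of [p], and [tau] for the variance of the noise in one
    coordinate, of order [d / alpha^2].  Under [p] the statistic has mean
    [d delta^2], and subtracting this mean leaves a degenerate U-statistic plus a
    linear term.  Their second moments are computed by induction on the sample
    size ([offdiag_sqr], [vsum_cov]) from the covariance
    [d (diag p - p p^T) + tau I] of a view, and are at most
    [(d^2 N^2 + d tau^2) / n^2] and [(d N + tau) d delta^2 / n] up to constants
    ([That_deviation]).  By the Markov inequality under the null hypothesis the
    threshold is at most [d delta^2 / 2], and by the same inequality under [p]
    the statistic exceeds [d delta^2 / 2] with probability at least [1 - beta],
    provided that [delta] dominates [1/n], [sqrt (N0 / n)] and
    [d^(1/4) / (alpha sqrt n)] ([dev_bound_separated], [second_kind_error]);
    here [N0] is the norm of [p0], and [N <= N0 + delta] transfers the bounds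
    from [p0] to [p].  Both rates in the theorem imply these three
    inequalities; the second one uses [N0 <= 1]. *)

(** * Means of integrable random variables *)

(** The integral of a non-integrable function is a junk value; keeping
    integrability together with the value of the integral makes all the rules
    below compose without side conditions. *)
Definition has_mean d (T : measurableType d) (R : realType)
    (P : probability T R) (f : T -> R) (m : R) : Prop :=
  P.-integrable [set: T] (EFin \o f) /\ (\int[P]_x (f x)%:E = m%:E)%E.

Section has_mean.
Context d (T : measurableType d) (R : realType) (P : probability T R).
Implicit Types (f g : T -> R) (a b c : R).

Lemma has_mean_measurable f a : has_mean P f a -> measurable_fun [set: T] f.
Proof. by move=> [/measurable_int /measurable_EFinP]. Qed.

Lemma eq_has_mean f g a b : f =1 g -> a = b -> has_mean P f a -> has_mean P g b.
Proof. by move=> /funext -> ->. Qed.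

Lemma has_mean_cst c : has_mean P (fun=> c) c.
Proof.
split; first exact: finite_measure_integrable_cst.
by rewrite (integral_cst P (@measurableT _ T)) [X in (_ * X)%E](probability_setT P) mule1.
Qed.

Lemma has_meanD f g a b :
  has_mean P f a -> has_mean P g b -> has_mean P (fun x => f x + g x) (a + b).
Proof.
move=> [fi fE] [gi gE]; split.
  by rewrite (_ : _ \o _ = (EFin \o f) \+ (EFin \o g))%E//; exact: integrableD.
under eq_integral do rewrite EFinD.
by rewrite integralD//= fE gE.
Qed.

Lemma has_meanZ c f a : has_mean P f a -> has_mean P (fun x => c * f x) (c * a).
Proof.
move=> [fi fE]; split.
  by rewrite (_ : _ \o _ = (fun x => c%:E * (EFin \o f) x)%E)//; exact: integrableZl.
under eq_integral do rewrite EFinM.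
by rewrite integralZl//= fE.
Qed.

Lemma has_mean_sum I (s : seq I) (F : I -> T -> R) (a : I -> R) :
  (forall i, has_mean P (F i) (a i)) ->
  has_mean P (fun x => \sum_(i <- s) F i x) (\sum_(i <- s) a i).
Proof.
move=> Fa; elim: s => [|i s ih].
  rewrite big_nil; under eq_fun do rewrite big_nil.
  exact: has_mean_cst.
rewrite big_cons; under eq_fun do rewrite big_cons.
exact: has_meanD.
Qed.

Lemma has_mean_indic (A : set T) a :
  measurable A -> P A = a%:E -> has_mean P (\1_A) a.
Proof.
move=> mA PA; split; last by rewrite integral_indic// setIT.
apply/integrableP; split; first exact/measurable_EFinP.
under eq_integral do rewrite /= ger0_norm//.
by rewrite integral_indic// setIT [X in (X < _)%E]PA ltry.
Qed.

Lemma has_mean_dominated f g a : measurable_fun [set: T] f ->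
  has_mean P g a -> (forall x, `|f x| <= g x) -> exists b, has_mean P f b.
Proof.
move=> mf [gi _] fg.
have fi : P.-integrable [set: T] (EFin \o f).
  apply: le_integrable gi => //; first exact/measurable_EFinP.
  move=> x _ /=; rewrite lee_fin (le_trans (fg x))//.
  exact: ler_norm.
exists (fine (\int[P]_x (f x)%:E)); split=> //.
by rewrite fineK// integrable_fin_num.
Qed.

Lemma has_meanM f g a b : measurable_fun [set: T] f ->
  measurable_fun [set: T] g -> has_mean P (fun x => f x ^+ 2) a ->
  has_mean P (fun x => g x ^+ 2) b -> exists c, has_mean P (fun x => f x * g x) c.
Proof.
move=> mf mg fa gb.
apply: (has_mean_dominated _ (has_meanD fa gb)).
  exact: measurable_funM.
move=> x; rewrite normrM.
have := sqr_ge0 (`|f x| - `|g x|).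
rewrite -[f x ^+ 2]real_normK ?num_real// -[g x ^+ 2]real_normK ?num_real//.
have := normr_ge0 (f x); have := normr_ge0 (g x); nra.
Qed.

Lemma has_mean_markov (A : set T) f c a : measurable A -> 0 < c ->
  (forall x, 0 <= f x) -> (forall x, A x -> c <= f x) ->
  has_mean P f a -> (P A <= (a / c)%:E)%E.
Proof.
move=> mA c0 f0 cf [fi fE].
have mf : measurable_fun [set: T] (EFin \o f) by exact: measurable_int fi.
rewrite EFinM muleC lee_pdivlMl// -fE.
rewrite -(setIT A) -integral_indic// -ge0_integralZl//=; last 2 first.
- exact/measurable_EFinP.
- by rewrite lee_fin ltW.
apply: ge0_le_integral => //.
- by move=> x _; rewrite mule_ge0// lee_fin ?ltW.
- by apply: emeasurable_funM => //; exact/measurable_EFinP.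
- move=> x _; rewrite -EFinM lee_fin indicE.
  by case: (boolP (x \in A)) => [/set_mem/cf|_]; rewrite ?mulr1 ?mulr0.
Qed.

End has_mean.

Section has_mean_transfer.
Context d1 d2 (T1 : measurableType d1) (T2 : measurableType d2) (R : realType).

Lemma has_mean_distribution (P : probability T1 R) (X : {mfun T1 >-> T2})
    (f : T2 -> R) a :
  measurable_fun [set: T2] f -> has_mean P (f \o X) a ->
  has_mean (distribution P X) f a.
Proof.
move=> mf [fi fE].
have mEf : measurable_fun [set: T2] (EFin \o f) by exact/measurable_EFinP.
split; first by apply: integrable_pushforward => //.
by rewrite integral_distribution.
Qed.

(** Independence, as Fubini for a product of functions of separate variables. *)
Lemma has_meanX (P : probability T1 R) (Q : probability T2 R)
    (f : T1 -> R) (g : T2 -> R) a b :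
  has_mean P f a -> has_mean Q g b ->
  has_mean (P \x Q)%E (fun z => f z.1 * g z.2) (a * b).
Proof.
move=> fa gb.
have mf := has_mean_measurable fa; have mg := has_mean_measurable gb.
move: fa gb => [fi fE] [gi gE].
have mfg : measurable_fun [set: T1 * T2] (fun z => (f z.1 * g z.2)%:E).
  apply/measurable_EFinP/measurable_funM.
    exact: measurableT_comp mf measurable_fst.
  exact: measurableT_comp mg measurable_snd.
have fgi : (P \x Q)%E.-integrable [set: T1 * T2] (fun z => (f z.1 * g z.2)%:E).
  apply/(integrable12ltyP _ _ mfg).
  have maf : measurable_fun [set: T1] (fun x => `|(f x)%:E|)%E.
    by apply: measurableT_comp => //; exact/measurable_EFinP.
  have mag : measurable_fun [set: T2] (fun x => `|(g x)%:E|)%E.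
    by apply: measurableT_comp => //; exact/measurable_EFinP.
  have gfin : (\int[Q]_y `|(g y)%:E| < +oo)%E by move/integrableP : gi => [].
  have ffin : (\int[P]_y `|(f y)%:E| < +oo)%E by move/integrableP : fi => [].
  under eq_integral => x _.
    under eq_integral do rewrite /fst /snd EFinM abseM.
    rewrite ge0_integralZl//.
    over.
  rewrite /= ge0_integralZr//; last exact: integral_ge0.
  apply: lte_mul_pinfty => //; first exact: integral_ge0.
  by rewrite ge0_fin_numE// integral_ge0.
split => //=.
rewrite -integral12_prod_meas1//= /fubini_F/=.
under eq_integral => x _.
  under eq_integral do rewrite EFinM.
  rewrite integralZl// gE muleC; over.
by rewrite /= integralZl// fE muleC.
Qed.

End has_mean_transfer.

(** * Second moments of sums and off-diagonal sums of an i.i.d. sample *)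

Section iid_mean.
Context d (T : measurableType d) (R : realType) (P : probability T R).
Implicit Types (f g : T -> R) (a b c : R).

(** The recursion on which all the moment computations over a sample rest:
    the first draw is independent of the others. *)
Lemma has_mean_iidS n (f : n.+1.-tuple T -> R) a :
  measurable_fun [set: n.+1.-tuple T] f ->
  has_mean (P \x iid P n)%E (fun z => f (tuple_cons z)) a ->
  has_mean (iid P n.+1) f a.
Proof. by move=> mf fa; apply: has_mean_distribution. Qed.

Lemma tnth_tuple_cons0 n (z : T * n.-tuple T) : tnth (tuple_cons z) ord0 = z.1.
Proof. by rewrite tnth0. Qed.

Lemma tnth_tuple_consS n (z : T * n.-tuple T) i :
  tnth (tuple_cons z) (lift ord0 i) = tnth z.2 i.
Proof. by rewrite tnthS. Qed.

Lemma measurable_fun_tnth n f (i : 'I_n) : measurable_fun [set: T] f ->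
  measurable_fun [set: n.-tuple T] (fun t => f (tnth t i)).
Proof. by move=> mf; exact: measurableT_comp mf (measurable_tnth i). Qed.

Lemma has_mean_iid_tnth n f a (i : 'I_n) :
  has_mean P f a -> has_mean (iid P n) (fun t => f (tnth t i)) a.
Proof.
move=> fa; have mf := has_mean_measurable fa.
elim: n i => [[]//|n ih i].
apply: has_mean_iidS; first exact: measurable_fun_tnth.
case: (unliftP ord0 i) => [j ->|->].
  apply: eq_has_mean (has_meanX (has_mean_cst P 1) (ih j)); last exact: mul1r.
  by move=> z; rewrite mul1r tnth_tuple_consS.
apply: eq_has_mean (has_meanX fa (has_mean_cst (iid P n) 1)); last exact: mulr1.
by move=> z; rewrite mulr1.
Qed.

Lemma has_mean_iid_tnth2 n f g a b (i j : 'I_n) : i != j ->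
  has_mean P f a -> has_mean P g b ->
  has_mean (iid P n) (fun t => f (tnth t i) * g (tnth t j)) (a * b).
Proof.
move=> ij fa gb.
have mf := has_mean_measurable fa; have mg := has_mean_measurable gb.
elim: n i j ij => [[]//|n ih i j ij].
apply: has_mean_iidS; first by apply: measurable_funM; exact: measurable_fun_tnth.
case: (unliftP ord0 i) ij => [i' ->|->]; case: (unliftP ord0 j) => [j' ->|->] ij.
- have ij' : i' != j' by apply: contraNneq ij => ->.
  apply: eq_has_mean (has_meanX (has_mean_cst P 1) (ih _ _ ij')); last exact: mul1r.
  by move=> z; rewrite mul1r !tnth_tuple_consS.
- apply: eq_has_mean (has_meanX gb (has_mean_iid_tnth i' fa)); last exact: mulrC.
  by move=> z; rewrite tnth_tuple_consS mulrC.
- apply: eq_has_mean (has_meanX fa (has_mean_iid_tnth j' gb)) => //.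
  by move=> z; rewrite tnth_tuple_consS.
- by rewrite eqxx in ij.
Qed.

End iid_mean.

Section Ustatistic.
Context d (T : measurableType d) (R : realType) (P : probability T R).
Variables (m : nat) (U : 'I_m -> T -> R).

(** [vsum k] and [offdiag] are the two ingredients of the Hoeffding
    decomposition of the statistic: its linear part and its degenerate part. *)
Definition vsum n (k : 'I_m) (t : n.-tuple T) : R := \sum_(i < n) U k (tnth t i).

Definition offdiag n (t : n.-tuple T) : R :=
  \sum_(i < n) \sum_(l < n | i != l) \sum_(k < m) U k (tnth t i) * U k (tnth t l).

Lemma vsum_cons n k (z : T * n.-tuple T) :
  vsum k (tuple_cons z) = U k z.1 + vsum k z.2.
Proof.
rewrite /vsum big_ord_recl tnth_tuple_cons0; congr (_ + _).
by apply: eq_bigr => i _; rewrite tnth_tuple_consS.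
Qed.

(** In this form the recursion in [n] and the effect of recentering become
    polynomial identities for each [k]. *)
Lemma offdiagE n (t : n.-tuple T) : offdiag t =
  \sum_(k < m) (vsum k t ^+ 2 - \sum_(i < n) U k (tnth t i) ^+ 2).
Proof.
rewrite /offdiag; under eq_bigr do rewrite exchange_big.
rewrite exchange_big /=; apply: eq_bigr => k _.
rewrite expr2 {1}/vsum mulr_suml -sumrB; apply: eq_bigr => i _.
rewrite -mulr_sumr /vsum [in RHS](bigD1 i)//= mulrDr -expr2.
rewrite addrAC subrr add0r; congr (_ * _).
by apply: eq_bigl => l; rewrite eq_sym.
Qed.

Lemma offdiag_cons n (z : T * n.-tuple T) : offdiag (tuple_cons z) =
  offdiag z.2 + 2 * \sum_(k < m) U k z.1 * vsum k z.2.
Proof.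
rewrite !offdiagE mulr_sumr -big_split/=; apply: eq_bigr => k _.
rewrite vsum_cons big_ord_recl tnth_tuple_cons0.
under [X in _ - (_ + X)]eq_bigr do rewrite tnth_tuple_consS.
ring.
Qed.

Hypothesis mU : forall k, measurable_fun [set: T] (U k).

Lemma measurable_vsum n k : measurable_fun [set: n.-tuple T] (vsum k).
Proof. by apply: measurable_sum => i; exact: measurable_fun_tnth. Qed.

Lemma measurable_offdiag n : measurable_fun [set: n.-tuple T] (@offdiag n).
Proof.
rewrite (_ : @offdiag n = fun t => \sum_(k < m)
  (vsum k t ^+ 2 - \sum_(i < n) U k (tnth t i) ^+ 2)); last first.
  by apply/funext => t; exact: offdiagE.
apply: measurable_sum => k; apply: measurable_funB.
  by apply: measurable_funX; exact: measurable_vsum.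
apply: measurable_sum => i; apply: measurable_funX.
exact: measurable_fun_tnth.
Qed.

Variable C : 'I_m -> 'I_m -> R.
Hypothesis U0 : forall k, has_mean P (U k) 0.
Hypothesis UC : forall k l, has_mean P (fun x => U k x * U l x) (C k l).

Lemma vsum_mean n k : has_mean (iid P n) (vsum k) 0.
Proof.
apply: eq_has_mean (has_mean_sum _ (fun i => has_mean_iid_tnth i (U0 k))) => //.
by rewrite big1.
Qed.

Lemma vsum_cov n k l :
  has_mean (iid P n) (fun t => vsum k t * vsum l t) (n%:R * C k l).
Proof.
elim: n => [|n ih].
  rewrite mul0r; apply: eq_has_mean (has_mean_cst _ 0) => // t.
  by rewrite /vsum !big_ord0 mulr0.
apply: has_mean_iidS; first by apply: measurable_funM; exact: measurable_vsum.
have E1 := has_meanX (UC k l) (has_mean_cst (iid P n) 1).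
have E2 := has_meanX (U0 k) (vsum_mean n l).
have E3 := has_meanX (U0 l) (vsum_mean n k).
have E4 := has_meanX (has_mean_cst P 1) ih.
apply: eq_has_mean (has_meanD (has_meanD E1 E2) (has_meanD E3 E4)).
  by move=> z; rewrite /= !vsum_cons; ring.
by rewrite -natr1; ring.
Qed.

(** In the square of the recursion [offdiag_cons] the cross term vanishes because
    the new draw is centered and independent of the others, and the last term
    contributes [4 n] times the squared Frobenius norm of the covariance. *)
Lemma offdiag_sqr n : has_mean (iid P n) (fun t => offdiag t ^+ 2)
  (2 * n%:R * (n%:R - 1) * \sum_(k < m) \sum_(l < m) C k l ^+ 2).
Proof.
elim: n => [|n ih].
  rewrite mulr0 !mul0r; apply: eq_has_mean (has_mean_cst _ 0) => // t.
  by rewrite /offdiag !big_ord0 expr0n.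
apply: has_mean_iidS; first by apply: measurable_funX; exact: measurable_offdiag.
have /choice[c cE] k : exists c,
    has_mean (iid P n) (fun t => offdiag t * vsum k t) c.
  by apply: has_meanM ih (vsum_cov n k k) => //; [exact: measurable_offdiag|
    exact: measurable_vsum].
have E1 := has_meanX (has_mean_cst P 1) ih.
have E2 := has_meanZ 4 (has_mean_sum (index_enum 'I_m)
  (fun k => has_meanX (U0 k) (cE k))).
have E3 := has_meanZ 4 (has_mean_sum (index_enum 'I_m)
  (fun k => has_mean_sum (index_enum 'I_m) (fun l =>
    has_meanX (UC k l) (vsum_cov n k l)))).
apply: eq_has_mean (has_meanD (has_meanD E1 E2) E3).
  move=> z; rewrite /= offdiag_cons.
  set B := \sum_(k < m) U k z.1 * vsum k z.2.
  rewrite (_ : \sum_(i < m) U i z.1 * (offdiag z.2 * vsum i z.2) = offdiag z.2 * B);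
    last by rewrite mulr_sumr; apply: eq_bigr => k _; rewrite mulrCA.
  rewrite (_ : \sum_(k < m) _ = B * B); first by ring.
  rewrite {1}/B mulr_suml; apply: eq_bigr => k _.
  by rewrite mulr_sumr; apply: eq_bigr => l _; rewrite mulrACA.
rewrite (big1 _ _ (fun k => 0 * c k)); last by move=> k _; rewrite mul0r.
rewrite (_ : \sum_(i < m) \sum_(j < m) C i j * (n%:R * C i j) =
    n%:R * \sum_(i < m) \sum_(j < m) C i j ^+ 2); last first.
  rewrite mulr_sumr; apply: eq_bigr => k _; rewrite mulr_sumr.
  by apply: eq_bigr => l _; rewrite mulrCA -expr2.
rewrite -natr1; ring.
Qed.

End Ustatistic.

(** * Moments of the Laplace noise *)

Section laplace_moments.
Import numFieldNormedType.Exports.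
Context {R : realType}.
Notation mu := (@lebesgue_measure R).
Local Notation s := (Num.sqrt 2 : R).

Lemma laplace_dominates : (@laplace R) `<< mu.
Proof.
apply/null_content_dominatesP => A mA muA0; apply: null_set_integral => //.
by apply/measurable_EFinP/measurable_funTS; exact: measurable_laplace_pdf.
Qed.

(** The Laplace law is defined by its density, so the Radon-Nikodym derivative is
    that density almost everywhere. *)
Lemma ge0_integral_laplace (f : R -> \bar R) :
  (forall x, 0 <= f x)%E -> measurable_fun [set: R] f ->
  (\int[@laplace R]_x f x = \int[mu]_x (f x * (laplace_pdf x)%:E))%E.
Proof.
move=> f0 mf.
rewrite -(Radon_Nikodym_SigmaFinite.change_of_variables laplace_dominates)//.
have rni := Radon_Nikodym_SigmaFinite.f_integrable laplace_dominates.
apply: ae_eq_integral => //.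
- by apply: emeasurable_funM => //; exact: (measurable_int _ rni).
- apply: emeasurable_funM => //; apply/measurable_EFinP.
  exact: measurable_laplace_pdf.
- apply: ae_eqe_mul2l; apply: integral_ae_eq => //.
    by apply/measurable_EFinP; exact: measurable_laplace_pdf.
  move=> E _ mE.
  by rewrite -(Radon_Nikodym_SigmaFinite.f_integral laplace_dominates).
Qed.

Lemma laplace_set1 (x : R) : laplace [set x] = 0%E.
Proof. by rewrite /laplace integral_set1. Qed.

Lemma laplace_pdf_even x : laplace_pdf (- x) = laplace_pdf x :> R.
Proof. by rewrite /laplace_pdf normrN. Qed.

(** With [y = x / sqrt 2], [x^2 / 4 <= e^y], and [e^-y] absorbs half of the
    exponential decay. *)
Lemma laplace_sqr_pdf_le x : 0 <= x ->
  x ^+ 2 * laplace_pdf x <= 4 * exponential_pdf (s / 2) x.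
Proof.
move=> x0.
have s0 : 0 < s by rewrite sqrtr_gt0.
have s2 : s ^+ 2 = 2 by rewrite sqr_sqrtr.
rewrite exponential_pdfE// /laplace_pdf ger0_norm//.
set y := s / 2 * x.
have y0 : 0 <= y by rewrite mulr_ge0// divr_ge0// ltW.
have -> : - s * x = - y - y by rewrite /y; field.
rewrite expRD mulNr -/y !expRN.
have := expR_ge1Dxn 1 y0; set e := expR y => ey.
have e0 : 0 < e by exact: expR_gt0.
have yx : y ^+ 2 = x ^+ 2 / 2.
  by rewrite /y exprMn expr_div_n s2; field.
have xe : x ^+ 2 <= 4 * e.
  by move: ey; rewrite yx (_ : 2`!%:R = 2)//; lra.
have -> : x ^+ 2 * (s^-1 * (e^-1 * e^-1)) = s^-1 * e^-1 ^+ 2 * x ^+ 2 by ring.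
have -> : 4 * (s / 2 / e) = s^-1 * e^-1 ^+ 2 * (4 * e).
  have -> : s / 2 = s^-1.
    apply: (@mulIf _ s); first by rewrite gt_eqF.
    by rewrite mulVf ?gt_eqF// mulrAC -expr2 s2 divff.
  by field; rewrite !gt_eqF.
by rewrite ler_wpM2l// mulr_ge0 ?sqr_ge0// invr_ge0 ltW.
Qed.

(** Finiteness of the second moment is enough: its value only enters the constant
    of the theorem. *)
Lemma laplace_sqr : exists v : R, has_mean laplace (fun x : R => x ^+ 2) v.
Proof.
have mf : measurable_fun [set: R] (fun x : R => x ^+ 2).
  exact: measurable_funX.
have s0 : 0 < s / 2 by rewrite divr_gt0// sqrtr_gt0.
suff oo : (\int[@laplace R]_x (x ^+ 2)%:E < +oo)%E.
  have fi : (@laplace R).-integrable [set: R] (fun x => (x ^+ 2)%:E).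
    apply/integrableP; split; first exact/measurable_EFinP.
    by under eq_integral do rewrite gee0_abs ?lee_fin ?sqr_ge0//.
  exists (fine (\int[@laplace R]_x (x ^+ 2)%:E)); split => //.
  by rewrite fineK// integrable_fin_num.
rewrite ge0_integral_laplace//; last 2 first.
- by move=> x; rewrite lee_fin sqr_ge0.
- exact/measurable_EFinP.
under eq_integral do rewrite -EFinM.
rewrite ge0_symfun_integralT; last 3 first.
- by move=> x; rewrite mulr_ge0 ?sqr_ge0 ?laplace_pdf_ge0.
- move=> x; apply: cvgM; last exact: continuous_laplace_pdf.
  exact: exprn_continuous.
- by move=> x /=; rewrite sqrrN laplace_pdf_even.
rewrite lte_mul_pinfty//.
apply: (@le_lt_trans _ _
    (\int[mu]_x (4%:E * (exponential_pdf (s / 2) x)%:E)))%E.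
  rewrite integral_mkcond; apply: ge0_le_integral => //.
  - move=> x _; rewrite patchE; case: ifP => // _.
    by rewrite lee_fin mulr_ge0 ?sqr_ge0 ?laplace_pdf_ge0.
  - apply/(measurable_restrictT _ _).1; first by rewrite -set_itvcy.
    apply/measurable_funTS/measurable_EFinP/measurable_funM => //.
    exact: measurable_laplace_pdf.
  - by apply/measurable_EFinP/measurable_funM => //; exact: measurable_exponential_pdf.
  - move=> x _; rewrite patchE; case: ifPn => [/set_mem /= x0|_].
      by rewrite lee_fin laplace_sqr_pdf_le.
    by rewrite lee_fin mulr_ge0// exponential_pdf_ge0// ltW.
rewrite ge0_integralZl//; last 2 first.
- by apply/measurable_EFinP; exact: measurable_exponential_pdf.
- by move=> x _; rewrite lee_fin exponential_pdf_ge0// ltW.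
by rewrite integral_exponential_pdf// mule1 ltry.
Qed.

(** Invariance of Lebesgue measure under [x |-> - x], restricted to functions
    living on one half-line so that a one-sided substitution rule applies. *)
Lemma ge0_integral_half_reflection (h : R -> R) : continuous h ->
  (forall x, 0 <= h x) -> (forall x, x <= 0 -> h x = 0) ->
  (\int[mu]_x (h x)%:E = \int[mu]_x (h (- x))%:E)%E.
Proof.
move=> ch h0 hneg.
have -> : (\int[mu]_x (h x)%:E = \int[mu]_(x in `[0%R, +oo[) (h x)%:E)%E.
  rewrite [RHS]integral_mkcond; apply: eq_integral => x _.
  rewrite patchE; case: ifPn => // /negP; rewrite inE/= in_itv/= andbT => /negP.
  by rewrite -ltNge => /ltW /hneg ->.
have -> : (\int[mu]_x (h (- x))%:E = \int[mu]_(x in `]-oo, (- 0)%R]) (h (- x))%:E)%E.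
  rewrite [RHS]integral_mkcond; apply: eq_integral => x _.
  rewrite patchE; case: ifPn => // /negP; rewrite inE/= in_itv/= => /negP.
  by rewrite oppr0 -ltNge => x0; rewrite hneg// oppr_le0 ltW.
rewrite (@ge0_integration_by_substitutionNy _ (fun x => h (- x)))//.
  by apply: eq_integral => x _ /=; rewrite opprK.
apply: continuous_subspaceT => x.
apply: (@continuous_comp _ _ _ (-%R : R^o -> R^o) h); last exact: ch.
exact: oppr_continuous.
Qed.

(** The positive and negative parts of a symmetric variable have the same mean. *)
Lemma laplace_mean : has_mean laplace (fun x : R => x) 0.
Proof.
have [v Ev] := laplace_sqr.
have [a [ai aE]] : exists a, has_mean laplace (fun x : R => x) a.
  apply: (has_mean_dominated _ (has_meanD (has_mean_cst _ 1) Ev)) => // x /=.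
  rewrite -[x ^+ 2]real_normK ?num_real//.
  by have := sqr_ge0 (`|x| - 1); have := normr_ge0 x; nra.
split=> //; rewrite integralE.
have mid : measurable_fun [set: R] (EFin : R -> \bar R) by exact/measurable_EFinP.
pose h x : R := Num.max x 0 * laplace_pdf x.
have posE : (\int[laplace]_x EFin^\+ x = \int[mu]_x (h x)%:E)%E.
  rewrite ge0_integral_laplace//; last exact: measurable_funepos.
  by apply: eq_integral => x _; rewrite funeposE -EFin_max -EFinM.
have negE : (\int[laplace]_x EFin^\- x = \int[mu]_x (h (- x))%:E)%E.
  rewrite ge0_integral_laplace//; last exact: measurable_funeneg.
  apply: eq_integral => x _.
  by rewrite funenegE -EFinN -EFin_max -EFinM /h laplace_pdf_even.
rewrite [X in (_ - X)%E]negE -ge0_integral_half_reflection.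
- rewrite -posE subee//; apply: integrable_fin_num => //.
  exact: integrable_funepos.
- move=> x; apply: cvgM; last exact: continuous_laplace_pdf.
  apply: (@continuous_max _ _ (fun x : R^o => x) (fun=> 0 : R^o)); first exact: cvg_id.
  exact: cvg_cst.
- by move=> x; rewrite mulr_ge0 ?laplace_pdf_ge0// le_max lexx orbT.
- by move=> x x0; rewrite /h max_r// mul0r.
Qed.

End laplace_moments.

(** * Mean and covariance of a private view *)

Section histogram.
Context {R : realType} (d : nat).
Implicit Types (k l : 'I_d) (p : pvec R d) (x : R).

Definition cell k : set (measurableTypeR R) :=
  `[k%:R / d%:R, k.+1%:R / d%:R[%classic.

Lemma measurable_cell k : measurable (cell k).
Proof. exact: measurable_itv. Qed.

Lemma dim_gt0 k : 0 < d%:R :> R.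
Proof. by rewrite ltr0n (leq_ltn_trans _ (ltn_ord k)). Qed.

Lemma in_cell k x : (x \in cell k) = (k%:R <= d%:R * x < k%:R + 1).
Proof.
have d0 := dim_gt0 k.
rewrite /cell mem_setE in_itv/= ler_pdivrMr// ltr_pdivlMr// mulrC.
by rewrite -natr1.
Qed.

(** This reduces all moments of the features to cell probabilities. *)
Lemma phiE k x : phi k x = Num.sqrt d%:R * \1_(cell k) x.
Proof.
rewrite /phi !indicE in_cell mem_setE in_itv/= subr_ge0 ltrBlDl.
by [].
Qed.

Lemma cell_disjoint k l x : x \in cell k -> x \in cell l -> k = l.
Proof.
rewrite !in_cell !natr1 => /andP[k1 k2] /andP[l1 l2]; apply/val_inj/eqP.
rewrite eqn_leq -ltnS -[X in _ && X]ltnS -!(ltr_nat R).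
by rewrite (le_lt_trans k1 l2) (le_lt_trans l1 k2).
Qed.

Lemma indic_cellM k l x :
  \1_(cell k) x * \1_(cell l) x = (k == l)%:R * \1_(cell k) x :> R.
Proof.
have [->|kl] := eqVneq k l.
  by rewrite !indicE; case: (_ \in _); rewrite ?mulr1 ?mulr0.
rewrite mul0r !indicE; case: (boolP (x \in cell k)) => xk; last by rewrite mul0r.
case: (boolP (x \in cell l)) => xl; last by rewrite mulr0.
by rewrite (cell_disjoint xk xl) eqxx in kl.
Qed.

Lemma indic_cell_density p k x :
  \1_(cell k) x * data_density p x = d%:R * p k * \1_(cell k) x.
Proof.
have -> : data_density p x = d%:R * \sum_(l < d) p l * \1_(cell l) x by [].
rewrite mulrCA -mulrA; congr (_ * _); rewrite mulr_sumr (bigD1 k)//= big1.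
  by rewrite addr0 [LHS]mulrCA indic_cellM eqxx mul1r.
by move=> l lk; rewrite [LHS]mulrCA indic_cellM eq_sym (negbTE lk) mul0r mulr0.
Qed.

Lemma lebesgue_cell k : lebesgue_measure (cell k) = (d%:R^-1)%:E :> \bar R.
Proof.
rewrite /cell lebesgue_measure_itv/= lte_fin cell_lt -EFinB -mulrBl.
by rewrite -natr1 addrAC subrr add0r mul1r.
Qed.

Lemma data_law_cell p k : data_law p (cell k) = (p k)%:E.
Proof.
rewrite data_lawE; last exact: measurable_cell.
have c0 : 0 <= d%:R * p k by rewrite mulr_ge0 ?pmass_ge0// ltW// (dim_gt0 k).
transitivity (\int[lebesgue_measure]_(x in cell k) (d%:R * p k)%:E)%E.
  apply: eq_integral => x xk; congr EFin.
  by have := indic_cell_density p k x; rewrite indicE xk mul1r mulr1.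
rewrite integral_cst; last exact: measurable_cell.
rewrite [X in (_ * X)%E]lebesgue_cell -EFinM mulrAC divff ?mul1r//.
by rewrite gt_eqF// (dim_gt0 k).
Qed.

Lemma alpha0E p k : alpha0 p k = Num.sqrt d%:R * p k.
Proof.
have d0 := dim_gt0 k.
have s0 : 0 <= Num.sqrt d%:R * (d%:R * p k) :> R.
  by rewrite !mulr_ge0 ?sqrtr_ge0 ?pmass_ge0// ltW.
rewrite /alpha0 /Rintegral.
under eq_integral do rewrite phiE -mulrA indic_cell_density mulrA EFinM.
rewrite ge0_integralZl//; last first.
  apply/measurable_EFinP/measurable_funTS/measurable_indic.
  exact: measurable_cell.
rewrite integral_indic//; last exact: measurable_cell.
rewrite setIidl; last first.
  apply: subset_itvScc; rewrite /= bnd_simp; first by rewrite divr_ge0// ltW.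
  by rewrite ler_pdivrMr// mul1r ler_nat.
rewrite [X in (_ * X)%E]lebesgue_cell -EFinM /=.
by rewrite -mulrA [_ * p k]mulrC mulfK// gt_eqF.
Qed.

Definition phic p k x : R := phi k x - Num.sqrt d%:R * p k.

Lemma has_mean_indic_cell p k : has_mean (data_law p) (\1_(cell k)) (p k).
Proof. by apply: has_mean_indic; [exact: measurable_cell|exact: data_law_cell]. Qed.

Lemma phic_mean p k : has_mean (data_law p) (phic p k) 0.
Proof.
have E := has_meanD (has_meanZ (Num.sqrt d%:R) (has_mean_indic_cell p k))
  (has_mean_cst _ (- (Num.sqrt d%:R * p k))).
by apply: eq_has_mean E; [move=> x; rewrite /phic phiE|rewrite subrr].
Qed.

(** Cells are disjoint, so distinct features have product zero and the covariance
    is that of a multinomial draw. *)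
Lemma phic_cov p k l : has_mean (data_law p) (fun x => phic p k x * phic p l x)
  (d%:R * ((k == l)%:R * p k - p k * p l)).
Proof.
have : Num.sqrt d%:R ^+ 2 = d%:R :> R by rewrite sqr_sqrtr.
set q := Num.sqrt d%:R => q2.
have E1 := has_meanZ (d%:R * (k == l)%:R) (has_mean_indic_cell p k).
have E2 := has_meanZ (- d%:R * p l) (has_mean_indic_cell p k).
have E3 := has_meanZ (- d%:R * p k) (has_mean_indic_cell p l).
have E4 := has_mean_cst (data_law p) (d%:R * p k * p l).
apply: eq_has_mean (has_meanD (has_meanD E1 E2) (has_meanD E3 E4)); last by ring.
by move=> x; rewrite /phic !phiE -/q -[X in X + _ + _]mulrA -indic_cellM -q2; ring.
Qed.

End histogram.

Section view_moments.
Context {R : realType} (d : nat) (alpha : R) (p : pvec R d).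
Variable v : R.
Hypothesis vP : has_mean laplace (fun x : R => x ^+ 2) v.

Definition viewc (k : 'I_d) (z : obs R d) : R := tnth z k - Num.sqrt d%:R * p k.

Lemma measurable_viewc k : measurable_fun [set: obs R d] (viewc k).
Proof.
by apply: measurable_funB => //; exact: measurable_tnth.
Qed.

Lemma viewc_viewE k xw : viewc k (view alpha xw) =
  phic p k xw.1 + noise_scale d alpha * tnth xw.2 k.
Proof. by rewrite /viewc tnth_mktuple /phic; ring. Qed.

Lemma noise_mean k : has_mean (iid laplace d) (fun w => tnth w k : R) 0.
Proof. exact: has_mean_iid_tnth laplace_mean. Qed.

Lemma noise_cov k l : has_mean (iid laplace d)
  (fun w => (tnth w k : R) * tnth w l) ((k == l)%:R * v).
Proof.
have [<-|kl] := eqVneq k l.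
  apply: eq_has_mean (has_mean_iid_tnth k vP) => [w|]; first by rewrite expr2.
  by rewrite mul1r.
apply: eq_has_mean (has_mean_iid_tnth2 kl laplace_mean laplace_mean) => //.
by rewrite !mul0r.
Qed.

Lemma viewc_mean k : has_mean (view_law alpha p) (viewc k) 0.
Proof.
apply: has_mean_distribution; first exact: measurable_viewc.
have E1 := has_meanX (phic_mean p k) (has_mean_cst (iid laplace d) 1).
have E2 := has_meanX (has_mean_cst (data_law p) (noise_scale d alpha))
  (noise_mean k).
apply: eq_has_mean (has_meanD E1 E2); last by rewrite mul0r mulr0 addr0.
by move=> xw /=; rewrite viewc_viewE mulr1.
Qed.

(** Multinomial covariance of the features plus independent noise. *)
Definition view_cov k l : R := d%:R * ((k == l)%:R * p k - p k * p l) +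
  noise_scale d alpha ^+ 2 * ((k == l)%:R * v).

Lemma viewc_cov k l :
  has_mean (view_law alpha p) (fun z => viewc k z * viewc l z) (view_cov k l).
Proof.
apply: has_mean_distribution.
  by apply: measurable_funM; exact: measurable_viewc.
have E1 := has_meanX (phic_cov p k l) (has_mean_cst (iid laplace d) 1).
have E2 := has_meanZ (noise_scale d alpha) (has_meanX (phic_mean p k) (noise_mean l)).
have E3 := has_meanZ (noise_scale d alpha) (has_meanX (phic_mean p l) (noise_mean k)).
have E4 := has_meanX (has_mean_cst (data_law p) (noise_scale d alpha ^+ 2))
  (noise_cov k l).
apply: eq_has_mean (has_meanD (has_meanD E1 E2) (has_meanD E3 E4)).
  by move=> xw /=; rewrite !viewc_viewE; ring.
by rewrite /view_cov; ring.
Qed.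

End view_moments.

(** * The statistic has no atom *)

Lemma measurable_level (R : realType) d (T : measurableType d) (f : T -> R) c :
  measurable_fun [set: T] f -> measurable [set x | f x = c].
Proof.
move=> mf; rewrite (_ : [set x | _] = [set: T] `&` f @^-1` [set c]).
  exact: mf.
by rewrite setTI.
Qed.

Section null_sets.
Context d1 d2 (T1 : measurableType d1) (T2 : measurableType d2) (R : realType).

Lemma product_null1 (P : probability T1 R) (Q : probability T2 R)
    (B : set (T1 * T2)) :
  (forall x, Q (xsection B x) = 0%E) -> (P \x Q)%E B = 0%E.
Proof. by move=> QB; rewrite /product_measure1 integral0_eq// => x _ /=. Qed.

(** The product measure is also obtained by integrating the measures of the
    sections at fixed second coordinate. *)
Lemma product_null2 (P : probability T1 R) (Q : probability T2 R)
    (B : set (T1 * T2)) (N : set T2) : measurable B -> measurable N ->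
  Q N = 0%E -> (forall y, ~ N y -> P (ysection B y) = 0%E) ->
  (P \x Q)%E B = 0%E.
Proof.
move=> mB mN QN PB.
rewrite (@product_measure_unique _ _ _ _ _ P Q (P \x^ Q)%E)//; last first.
  by move=> ? ? ? ? /=; rewrite product_measure2E.
rewrite /= /product_measure2.
rewrite (@ge0_negligible_integral _ _ _ Q setT N)//.
- by rewrite integral0_eq// => y [_ Ny]; exact: PB.
- exact: measurable_fun_ysection.
Qed.

End null_sets.

(** Conditioning on all draws but the first. *)
Lemma iid_null d (T : measurableType d) (R : realType) (P : probability T R) n
    (A : set (n.+1.-tuple T)) (N : set (n.-tuple T)) :
  measurable A -> measurable N -> iid P n N = 0%E ->
  (forall t, ~ N t -> P [set x | A (tuple_cons (x, t))] = 0%E) ->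
  iid P n.+1 A = 0%E.
Proof.
move=> mA mN N0 PA.
have mB : measurable (@tuple_cons _ T n @^-1` A).
  by rewrite -[X in measurable X]setTI; exact: measurable_tuple_cons.
change ((P \x iid P n)%E (@tuple_cons _ T n @^-1` A) = 0%E).
apply: (product_null2 mB mN N0) => t Nt; rewrite -[RHS](PA t Nt).
by congr (P _); apply/seteqP; split => x; rewrite /ysection/= inE.
Qed.

Section hyperplanes.
Context {R : realType}.

(** Once the other coordinates are fixed, the equation determines the coordinate
    [ord0], and a single point is null for the Laplace law. *)
Lemma laplace_hyperplane m (s : 'I_m.+1 -> R) c : s ord0 != 0 ->
  iid laplace m.+1 [set w | \sum_(k < m.+1) s k * tnth w k = c] = 0%E.
Proof.
move=> s0.
have mH : measurable
    [set w : obs R m.+1 | \sum_(k < m.+1) s k * tnth w k = c].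
  apply: measurable_level; apply: measurable_sum => k.
  by apply: measurable_funM => //; exact: measurable_tnth.
apply: (iid_null mH measurable0 (measure0 _)) => t _.
have sumE (x : R) : \sum_(k < m.+1) s k * tnth (tuple_cons (x, t)) k =
    s ord0 * x + \sum_(k < m) s (lift ord0 k) * tnth t k.
  rewrite big_ord_recl tnth_tuple_cons0; congr (_ + _).
  by apply: eq_bigr => k _; rewrite tnth_tuple_consS.
rewrite -[RHS](laplace_set1 ((c - \sum_(k < m) s (lift ord0 k) * tnth t k) / s ord0)).
congr (laplace _); apply/seteqP; split => x /=; rewrite sumE.
  by move=> <-; rewrite addrK mulrAC divff// mul1r.
by move=> ->; rewrite mulrC divfK// subrK.
Qed.

Lemma view_hyperplane d (alpha : R) (p : pvec R d.+1) (s : 'I_d.+1 -> R) c :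
  0 < alpha -> s ord0 != 0 ->
  view_law alpha p [set z | \sum_(k < d.+1) s k * tnth z k = c] = 0%E.
Proof.
move=> a0 s0; apply: product_null1 => x.
have sg0 : noise_scale d.+1 alpha != 0.
  by rewrite gt_eqF// /noise_scale !mulr_gt0 ?invr_gt0 ?sqrtr_gt0 ?ltr0n.
pose s' k := s k * noise_scale d.+1 alpha.
have s'0 : s' ord0 != 0 by rewrite mulf_neq0.
have sumE (w : obs R d.+1) : \sum_(k < d.+1) s k * tnth (view alpha (x, w)) k =
    \sum_(k < d.+1) s' k * tnth w k + \sum_(k < d.+1) s k * phi k x.
  rewrite -big_split; apply: eq_bigr => k _.
  by rewrite tnth_mktuple /s'/=; ring.
rewrite -[RHS](laplace_hyperplane (c - \sum_(k < d.+1) s k * phi k x) s'0).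
congr (iid _ _ _); apply/seteqP; split => w; rewrite /xsection/= inE/= sumE.
  by move=> <-; rewrite addrK.
by move=> ->; rewrite subrK.
Qed.

End hyperplanes.

Section no_atom.
Context {R : realType} (d n : nat) (alpha : R).

Lemma That_offdiag (p0 : pvec R d) (z : n.-tuple (obs R d)) :
  That p0 z = (n%:R * (n%:R - 1))^-1 * offdiag (viewc p0) z.
Proof.
rewrite /That /offdiag; congr (_ * _); apply: eq_bigr => i _.
by apply: eq_bigr => l _; apply: eq_bigr => k _; rewrite alpha0E.
Qed.

End no_atom.

(** Given the draws after the first one, with coordinatewise centered sum [s], the
    event is a hyperplane with normal vector [s] in the first draw; and [s] has a
    nonzero first coordinate almost surely, again by the hyperplane lemma. *)
Lemma That_no_atom (R : realType) (d n : nat) (alpha : R)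
    (p0 p : pvec R d) (c : R) :
  (1 <= d)%N -> (2 <= n)%N -> 0 < alpha ->
  private_law alpha p n [set z | That p0 z = c] = 0%E.
Proof.
case: d p0 p => // d p0 p _; case: n => [//|[//|n]] _ a0.
have mviewc := @measurable_viewc R d.+1 p0.
pose N : set (n.+1.-tuple (obs R d.+1)) := [set t | vsum (viewc p0) ord0 t = 0].
have mN : measurable N by apply: measurable_level; exact: measurable_vsum.
have N0 : iid (view_law alpha p) n.+1 N = 0%E.
  apply: (iid_null mN measurable0 (measure0 _)) => t _.
  pose s (k : 'I_d.+1) : R := (k == ord0)%:R.
  have s0 : s ord0 != 0 by rewrite /s eqxx oner_eq0.
  have sumE (x : obs R d.+1) : \sum_(k < d.+1) s k * tnth x k = tnth x ord0.
    rewrite (bigD1 ord0)//= /s eqxx mul1r big1 ?addr0// => k /negbTE ->.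
    by rewrite mul0r.
  rewrite -[RHS](view_hyperplane p
    (Num.sqrt d.+1%:R * p0 ord0 - vsum (viewc p0) ord0 t) a0 s0).
  congr (view_law _ _ _); apply/seteqP; split => x /=;
    rewrite sumE /N/= vsum_cons/= /viewc.
    by move=> E; apply/eqP; rewrite -subr_eq0 -E; apply/eqP; ring.
  by move=> ->; ring.
have n2 : n.+2%:R * (n.+2%:R - 1) != 0 :> R.
  by rewrite mulf_neq0 ?pnatr_eq0// -natr1 addrK pnatr_eq0.
have mT : measurable [set z | That (n := n.+2) p0 z = c].
  by apply: measurable_level; exact: measurable_That.
apply: (iid_null mT mN N0) => t Nt.
have s0 : vsum (viewc p0) ord0 t != 0 by apply/eqP.
pose D := \sum_(k < d.+1) vsum (viewc p0) k t * (Num.sqrt d.+1%:R * p0 k).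
rewrite -[RHS](view_hyperplane (s := fun k => vsum (viewc p0) k t) p
  ((n.+2%:R * (n.+2%:R - 1) * c - offdiag (viewc p0) t) / 2 + D) a0 s0).
have sumE (x : obs R d.+1) : \sum_(k < d.+1) vsum (viewc p0) k t * tnth x k =
    \sum_(k < d.+1) viewc p0 k x * vsum (viewc p0) k t + D.
  rewrite -big_split; apply: eq_bigr => k _ /=.
  by rewrite /viewc; ring.
congr (view_law _ _ _); apply/seteqP; split => x /=;
    rewrite That_offdiag offdiag_cons sumE/=.
  by move=> <-; rewrite mulVKf//; field.
by move/addIr => ->; rewrite [2 * _]mulrC divfK// [offdiag _ _ + _]addrC subrK mulKf.
Qed.

(** * Quantiles and the exact level *)

Section quantile.
Context d (T : measurableType d) (R : realType) (P : probability T R).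
Variable X : {RV P >-> R}.
Variable u : R.
Hypothesis u01 : 0 < u < 1.
Import numFieldNormedType.Exports.

Let S : set R := [set t | (u%:E <= cdf X t)%E].

Let S_lbound : has_lbound S.
Proof.
have [u0 u1] := andP u01.
have [[M cM]|cM] := pselect (exists M, (cdf X M < u%:E)%E).
  exists M => t; rewrite /S/= => ut; rewrite leNgt; apply/negP => tM.
  by have := le_lt_trans ut (le_lt_trans (cdf_nondecreasing X (ltW tM)) cM); rewrite ltxx.
suff : (u%:E <= 0)%E by rewrite lee_fin leNgt u0.
apply: (cvge_to_ge (cvg_cdfNy0 X)); apply: nearW => t.
by rewrite leNgt; apply/negP => tu; apply: cM; exists t.
Qed.

Let S_nonempty : S !=set0.
Proof.
have [u0 u1] := andP u01.
have [//|S0] := pselect (S !=set0).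
suff : (1%:E <= u%:E)%E by rewrite lee_fin leNgt u1.
apply: (cvge_to_le (cvg_cdfy1 X)); apply: nearW => t.
by apply/ltW; rewrite ltNge; apply/negP => ut; apply: S0; exists t.
Qed.

Lemma quantile_le s : (u%:E <= cdf X s)%E -> quantile X u <= s.
Proof. by move=> us; apply: ge_inf. Qed.

(** Right continuity of the distribution function: the infimum defining the
    quantile is attained. *)
Lemma cdf_quantile_ge : (u%:E <= cdf X (quantile X u))%E.
Proof.
apply: (cvge_to_ge (@cdf_right_continuous _ _ _ _ X (quantile X u))).
near=> t.
have : quantile X u < t by near: t; exact: nbhs_right_gt.
move=> /(inf_lt S_nonempty)[s Ss st].
by rewrite (le_trans Ss)// cdf_nondecreasing// ltW.
Unshelve. all: by end_near. Qed.

(** Below the quantile the distribution function is smaller than [u], and the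
    event is the increasing union of the events [X <= quantile - 1/(n+1)]. *)
Lemma prob_lt_quantile : (P [set x | (X x < quantile X u)%R] <= u%:E)%E.
Proof.
set q := quantile X u.
pose F (n : nat) := X @^-1` `]-oo, q - n.+1%:R^-1].
have mF n : measurable (F n) by exact: measurable_funPTI.
have -> : [set x | X x < q] = \bigcup_n F n.
  apply/seteqP; split => x /=.
    move=> Xq; have : `[X x, q[%classic (X x) by rewrite /= in_itv/= lexx.
    rewrite itv_bnd_open_bigcup => -[n _]; rewrite /= in_itv/= => /andP[_ xn].
    by exists n => //; rewrite /F/= in_itv.
  move=> [n _]; rewrite /F/= in_itv/= => /le_lt_trans; apply.
  by rewrite ltrBlDr ltrDl invr_gt0.
apply: (cvge_to_le (@nondecreasing_cvg_mu _ _ _ P F mF _ _)).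
- exact: bigcupT_measurable.
- move=> n m nm; apply/subsetPset => x; rewrite /F/= !in_itv/= => /le_trans; apply.
  by rewrite lerD2l lerN2 lef_pV2 ?posrE// ler_nat.
- apply: nearW => n; apply/ltW; rewrite ltNge; apply/negP => un.
  have : q <= q - n.+1%:R^-1 by apply: quantile_le.
  by rewrite leNgt ltrBlDr ltrDl invr_gt0 ltr0n.
Qed.

Lemma prob_gt_quantile : P [set x | X x = quantile X u] = 0%E ->
  P [set x | (quantile X u < X x)%R] = (1 - u)%:E.
Proof.
set q := quantile X u => Pq.
have mq : measurable [set x | X x = q] by exact: measurable_level.
have mlt : measurable [set x | X x < q].
  rewrite (_ : [set x | _] = X @^-1` `]-oo, q[); first exact: measurable_funPTI.
  by apply/seteqP; split => x /=; rewrite in_itv.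
have cE : cdf X q = u%:E.
  apply/eqP; rewrite eq_le cdf_quantile_ge andbT.
  rewrite (le_trans _ prob_lt_quantile)//.
  apply: (@le_trans _ _ (P ([set x | X x < q] `|` [set x | X x = q]))).
    apply: (@le_measure _ _ _ P); rewrite ?inE//.
    - exact: measurable_funPTI.
    - exact: measurableU.
    by move=> x /=; rewrite in_itv/= le_eqVlt => /predU1P[]; [right|left].
  by rewrite (le_trans (measureU2 _ _ _))// [X in (_ + X)%E]Pq adde0.
have -> : [set x | q < X x] = ~` (X @^-1` `]-oo, q]).
  by apply/seteqP; split => x /=; rewrite in_itv/= ltNge => /negP.
by rewrite probability_setC ?EFinB -?cE//; exact: measurable_funPTI.
Qed.

End quantile.

Lemma first_kind_error (R : realType) (d n : nat) (alpha gamma : R)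
    (p0 : pvec R d) : 0 < gamma < 1 ->
  (1 <= d)%N -> (2 <= n)%N -> 0 < alpha ->
  private_law alpha p0 n [set z | Delta alpha gamma p0 z = true] = gamma%:E.
Proof.
move=> /andP[g0 g1] d1 n2 a0.
have u01 : 0 < 1 - gamma < 1 by rewrite subr_gt0 g1 ltrBlDr ltrDl g0.
pose T := That p0 : {RV private_law alpha p0 n >-> R}.
have := prob_gt_quantile (X := T) u01 (That_no_atom p0 p0 _ d1 n2 a0).
by rewrite subKr => <-.
Qed.

(** * Hoeffding decomposition and covariance bounds *)

Section offdiag_shift.
Context d (T : measurableType d) (R : realType) (m : nat).
Variables (U U' : 'I_m -> T -> R) (D : 'I_m -> R).
Hypothesis UD : forall k x, U' k x = U k x + D k.

(** Recentering splits off the linear part and the mean; this is the Hoeffding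
    decomposition of the statistic. *)
Lemma offdiag_shift n (t : n.-tuple T) : offdiag U' t = offdiag U t +
  2 * (n%:R - 1) * (\sum_(k < m) D k * vsum U k t) +
  n%:R * (n%:R - 1) * \sum_(k < m) D k ^+ 2.
Proof.
rewrite !offdiagE !mulr_sumr -!big_split/=; apply: eq_bigr => k _.
have -> : vsum U' k t = vsum U k t + n%:R * D k.
  rewrite /vsum; under eq_bigr do rewrite UD.
  by rewrite big_split/= sumr_const card_ord mulr_natl.
have -> : \sum_(i < n) U' k (tnth t i) ^+ 2 =
    \sum_(i < n) U k (tnth t i) ^+ 2 + 2 * D k * vsum U k t + n%:R * D k ^+ 2.
  have -> : n%:R * D k ^+ 2 = \sum_(i < n) D k ^+ 2.
    by rewrite sumr_const card_ord mulr_natl.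
  rewrite /vsum mulr_sumr -!big_split/=; apply: eq_bigr => i _.
  by rewrite UD; ring.
ring.
Qed.

End offdiag_shift.

Section pvec_norm.
Context {R : realType} (d : nat).
Implicit Types p q : pvec R d.

Definition norm2 (x : 'I_d -> R) : R := Num.sqrt (\sum_(k < d) x k ^+ 2).

Lemma norm2_sqr x : norm2 x ^+ 2 = \sum_(k < d) x k ^+ 2.
Proof. by rewrite sqr_sqrtr// sumr_ge0// => k _; exact: sqr_ge0. Qed.

Lemma norm2_ge0 x : 0 <= norm2 x. Proof. exact: sqrtr_ge0. Qed.

Lemma le_norm2 x k : `|x k| <= norm2 x.
Proof.
rewrite -sqrtr_sqr; apply: ler_wsqrtr.
by rewrite (bigD1 k)//= lerDl sumr_ge0// => i _; exact: sqr_ge0.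
Qed.

Lemma pmass_le1 p k : p k <= 1.
Proof.
rewrite -(pmass_sum1 p) (bigD1 k)//= lerDl sumr_ge0// => i _.
exact: pmass_ge0.
Qed.

Lemma norm2_le1 p : norm2 p <= 1.
Proof.
rewrite -[leRHS]sqrtr1; apply: ler_wsqrtr; rewrite -(pmass_sum1 p).
by apply: ler_sum => k _; rewrite expr2 ler_piMl ?pmass_ge0 ?pmass_le1.
Qed.

Lemma norm2_cauchy_schwarz (y z : 'I_d -> R) :
  \sum_(k < d) y k * z k <= norm2 y * norm2 z.
Proof.
have y0 := norm2_ge0 y; have z0 := norm2_ge0 z.
have null x k : norm2 x = 0 -> x k = 0.
  by move=> x0; apply/eqP; rewrite -normr_le0 -x0 le_norm2.
(* the expansion below can be divided by [norm2 y * norm2 z] only if positive *)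
have [yz0|] := ltP 0 (norm2 y * norm2 z); last first.
  rewrite le_eqVlt ltNge mulr_ge0//= orbF mulf_eq0 => yz0.
  rewrite big1 ?mulr_ge0// => k _.
  by case/orP: yz0 => /eqP /null ->; rewrite ?mul0r ?mulr0.
rewrite -(ler_pM2l yz0) -subr_ge0.
suff : 0 <= \sum_(k < d) (norm2 z * y k - norm2 y * z k) ^+ 2.
  have -> : \sum_(k < d) (norm2 z * y k - norm2 y * z k) ^+ 2 =
      norm2 z ^+ 2 * \sum_(k < d) y k ^+ 2 + norm2 y ^+ 2 * \sum_(k < d) z k ^+ 2
      - 2 * (norm2 y * norm2 z) * \sum_(k < d) y k * z k.
    rewrite !mulr_sumr -big_split -sumrB; apply: eq_bigr => k _ /=; ring.
  by rewrite -!norm2_sqr; lra.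
by apply: sumr_ge0 => k _; exact: sqr_ge0.
Qed.

Lemma norm2_triangle (x y : 'I_d -> R) :
  norm2 x <= norm2 y + norm2 (fun k => x k - y k).
Proof.
set z := fun k => _.
have yz0 := norm2_ge0 y; have z0 := norm2_ge0 z.
have CS : \sum_(k < d) y k * z k <= norm2 y * norm2 z.
  exact: norm2_cauchy_schwarz.
rewrite -(ler_sqr (norm2_ge0 x)) ?nnegrE ?addr_ge0// sqrrD !norm2_sqr.
have -> : \sum_(k < d) x k ^+ 2 = \sum_(k < d) y k ^+ 2 +
    (\sum_(k < d) y k * z k) *+ 2 + \sum_(k < d) z k ^+ 2.
  rewrite -mulr_natl mulr_sumr -!big_split/=; apply: eq_bigr => k _.
  by rewrite /z; ring.
by rewrite lerD2r lerD2l lerMn2r CS orbT.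
Qed.

End pvec_norm.

Section cov_bounds.
Context {R : realType} (d : nat) (alpha v : R) (p : pvec R d).
Let tau := noise_scale d alpha ^+ 2 * v.

Lemma sum_diag (F : 'I_d -> 'I_d -> R) :
  \sum_(k < d) \sum_(l < d) (k == l)%:R * F k l = \sum_(k < d) F k k.
Proof.
apply: eq_bigr => k _; rewrite (bigD1 k)//= eqxx mul1r big1 ?addr0// => l lk.
by rewrite eq_sym (negbTE lk) mul0r.
Qed.

(** Frobenius norm of the covariance.  The multinomial part contributes through
    [(a - b)^2 <= a^2 + b^2] for nonnegative [a, b], and the fourth power of
    the norm of [p] is at most its square. *)
Lemma view_cov_sqr_le : \sum_(k < d) \sum_(l < d) view_cov alpha p v k l ^+ 2 <=
  4 * d%:R ^+ 2 * norm2 p ^+ 2 + 2 * d%:R * tau ^+ 2.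
Proof.
have N1 : (norm2 p ^+ 2) ^+ 2 <= norm2 p ^+ 2.
  rewrite [leLHS]expr2 ler_piMl ?sqr_ge0//.
  by rewrite expr_le1 ?norm2_le1 ?norm2_ge0.
apply: (@le_trans _ _ (\sum_(k < d) \sum_(l < d)
   ((k == l)%:R * (2 * d%:R ^+ 2 * p k ^+ 2 + 2 * tau ^+ 2) +
    (2 * d%:R ^+ 2) * (p k ^+ 2 * p l ^+ 2)))).
  apply: ler_sum => k _; apply: ler_sum => l _; rewrite /view_cov mulrCA -/tau.
  have pk := pmass_ge0 p k; have pl := pmass_ge0 p l.
  set b := (k == l)%:R; have b2 : b * b = b.
    by rewrite /b; case: (k == l); rewrite ?mulr1 ?mulr0.
  have b0 : 0 <= b by rewrite /b.
  set a := d%:R * (b * p k - p k * p l).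
  have sq : (a + b * tau) ^+ 2 <= 2 * a ^+ 2 + 2 * (b * tau) ^+ 2.
    by rewrite -subr_ge0; have -> : 2 * a ^+ 2 + 2 * (b * tau) ^+ 2 - (a + b * tau) ^+ 2
      = (a - b * tau) ^+ 2; [ring|exact: sqr_ge0].
  apply: (le_trans sq).
  have -> : (b * tau) ^+ 2 = b * tau ^+ 2 by rewrite -{2}b2; ring.
  have -> : a ^+ 2 = d%:R ^+ 2 * (b * p k ^+ 2 + p k ^+ 2 * p l ^+ 2) -
      2 * (d%:R ^+ 2 * (b * p k * p k * p l)).
    by rewrite /a -{2}b2; ring.
  have : 0 <= d%:R ^+ 2 * (b * p k * p k * p l).
    by rewrite !mulr_ge0.
  lra.
under eq_bigr do rewrite big_split/=.
rewrite big_split/= sum_diag big_split/= -mulr_sumr sumr_const card_ord.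
under [X in _ + X]eq_bigr do rewrite -mulr_sumr -mulr_sumr -norm2_sqr.
rewrite -mulr_sumr -mulr_suml -norm2_sqr -mulr_natl.
have : d%:R ^+ 2 * (norm2 p ^+ 2 * norm2 p ^+ 2) <= d%:R ^+ 2 * norm2 p ^+ 2.
  by rewrite ler_wpM2l ?sqr_ge0// -expr2.
lra.
Qed.

(** Variance of a linear form of the view: [- p p^T] only decreases it, and
    [diag p] is at most the norm of [p]. *)
Lemma view_cov_quad_le (D : 'I_d -> R) :
  \sum_(k < d) \sum_(l < d) D k * D l * view_cov alpha p v k l <=
  (d%:R * norm2 p + tau) * \sum_(k < d) D k ^+ 2.
Proof.
have -> : \sum_(k < d) \sum_(l < d) D k * D l * view_cov alpha p v k l =
  \sum_(k < d) (d%:R * (D k ^+ 2 * p k) + tau * D k ^+ 2)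
    - d%:R * (\sum_(k < d) D k * p k) ^+ 2.
  rewrite -(sum_diag (fun k l => d%:R * (D k * D l * p k) + tau * (D k * D l))).
  rewrite expr2 mulr_suml mulr_sumr -sumrB.
  apply: eq_bigr => k _; rewrite !mulr_sumr -sumrB; apply: eq_bigr => l _.
  by rewrite /view_cov mulrCA -/tau; case: eqVneq => [->|_]; ring.
apply: (le_trans (_ : _ <= \sum_(k < d) (d%:R * (D k ^+ 2 * p k) + tau * D k ^+ 2))).
  by rewrite gerBl mulr_ge0 ?sqr_ge0.
rewrite mulr_sumr; apply: ler_sum => k _.
rewrite [leRHS]mulrDl lerD2r -mulrA ler_wpM2l// mulrC.
by rewrite ler_wpM2r ?sqr_ge0// (le_trans (ler_norm _))// le_norm2.
Qed.

End cov_bounds.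

(** * Deviation of the statistic and second kind error *)

Section power.
Context {R : realType}.
Variable v : R.
Hypothesis vP : has_mean laplace (fun x : R => x ^+ 2) v.

Lemma noise_var_ge0 : 0 <= v.
Proof.
case: vP => _ vE; rewrite -lee_fin -vE integral_ge0// => x _.
by rewrite lee_fin sqr_ge0.
Qed.

Definition dist2 d (p q : pvec R d) : R := norm2 (fun k => p k - q k).

(** Bound on the second moment of the centered statistic, where [N] is the norm of
    the sampling distribution and [D] its distance to the null.  The first
    summand comes from the degenerate part, the second one from the linear part. *)
Definition dev_bound (d n tau N D : R) : R :=
  8 * (4 * d ^+ 2 * N ^+ 2 + 2 * d * tau ^+ 2) / n ^+ 2 +
  8 * (d * N + tau) * (d * D ^+ 2) / n.

Lemma measurable_dev d n (p0 : pvec R d) (c e : R) :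
  measurable [set z : n.-tuple (obs R d) | c <= `|That p0 z - e|].
Proof.
rewrite (_ : [set z | _] = (fun z : n.-tuple (obs R d) =>
    `|That p0 z - e|) @^-1` `[c, +oo[).
  rewrite -[X in measurable X]setTI; apply: measurableT_comp => //.
  apply: measurable_funB => //; exact: measurable_That.
by apply/seteqP; split => z /=; rewrite in_itv/= andbT.
Qed.

Lemma measurable_That_le d n (p0 : pvec R d) (c : R) :
  measurable [set z : n.-tuple (obs R d) | That p0 z <= c].
Proof.
rewrite (_ : [set z | _] = (fun z : n.-tuple (obs R d) =>
    That p0 z) @^-1` `]-oo, c]).
  rewrite -[X in measurable X]setTI; exact: measurable_That.
by apply/seteqP; split => z /=; rewrite in_itv.
Qed.

Definition noise_var d (alpha : R) : R := noise_scale d alpha ^+ 2 * v.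

(** Second-moment concentration of the statistic around its mean.  The degenerate
    and linear parts are handled separately through
    [(Y + G)^2 <= 2 Y^2 + 2 G^2]. *)
Lemma That_deviation d n (alpha : R) (p0 p : pvec R d) (c : R) :
  (2 <= n)%N -> 0 < c ->
  (private_law alpha p n
     [set z | (c <= `|That p0 z - d%:R * dist2 p p0 ^+ 2|)%R]
   <= (dev_bound d%:R n%:R (noise_var d alpha) (norm2 p) (dist2 p p0) / c ^+ 2)%:E)%E.
Proof.
move=> n2 c0.
have n0 : 0 < n%:R :> R by rewrite ltr0n (ltn_trans _ n2).
have n1 : 0 < n%:R - 1 :> R by rewrite subr_gt0 ltr1n.
pose D k : R := Num.sqrt d%:R * (p k - p0 k).
have DE : \sum_(k < d) D k ^+ 2 = d%:R * dist2 p p0 ^+ 2.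
  rewrite norm2_sqr mulr_sumr; apply: eq_bigr => k _.
  by rewrite /D exprMn sqr_sqrtr.
pose Y (z : n.-tuple (obs R d)) : R := (n%:R * (n%:R - 1))^-1 * offdiag (viewc p) z.
pose G (z : n.-tuple (obs R d)) : R := 2 / n%:R * \sum_(k < d) D k * vsum (viewc p) k z.
have TE z : That p0 z - d%:R * dist2 p p0 ^+ 2 = Y z + G z.
  rewrite That_offdiag (@offdiag_shift _ _ _ _ (viewc p) _ D); last first.
    by move=> k x; rewrite /viewc /D; ring.
  by rewrite DE /Y /G; field; rewrite !gt_eqF.
have mviewc := @measurable_viewc R d p.
have EY : has_mean (private_law alpha p n) (fun z => Y z ^+ 2)
    ((n%:R * (n%:R - 1))^-1 ^+ 2 * (2 * n%:R * (n%:R - 1) *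
      \sum_(k < d) \sum_(l < d) view_cov alpha p v k l ^+ 2)).
  have := has_meanZ ((n%:R * (n%:R - 1))^-1 ^+ 2)
    (offdiag_sqr mviewc (viewc_mean alpha p) (viewc_cov alpha p vP) n).
  by apply: eq_has_mean => // z; rewrite /Y exprMn.
have EG : has_mean (private_law alpha p n) (fun z => G z ^+ 2)
    ((2 / n%:R) ^+ 2 * \sum_(k < d) \sum_(l < d)
       D k * D l * (n%:R * view_cov alpha p v k l)).
  have := has_meanZ ((2 / n%:R) ^+ 2) (has_mean_sum (index_enum 'I_d)
    (fun k => has_mean_sum (index_enum 'I_d) (fun l => has_meanZ (D k * D l)
     (vsum_cov mviewc (viewc_mean alpha p) (viewc_cov alpha p vP) n k l)))).
  apply: eq_has_mean => // z; rewrite /G [in RHS]exprMn; congr (_ * _).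
  rewrite [RHS]expr2 mulr_suml; apply: eq_bigr => k _.
  by rewrite mulr_sumr; apply: eq_bigr => l _; rewrite mulrACA.
have EH := has_meanD (has_meanZ 2 EY) (has_meanZ 2 EG).
apply: (le_trans (has_mean_markov _ (exprn_gt0 2 c0) _ _ EH)).
- exact: measurable_dev.
- by move=> z; rewrite addr_ge0// mulr_ge0// sqr_ge0.
- move=> z /=; rewrite TE => cz.
  apply: (@le_trans _ _ ((Y z + G z) ^+ 2)).
    rewrite -[leRHS]real_normK ?num_real// ler_sqr ?nnegrE//; exact: ltW.
  rewrite -subr_ge0; have -> : 2 * Y z ^+ 2 + 2 * G z ^+ 2 - (Y z + G z) ^+ 2 =
    (Y z - G z) ^+ 2 by ring.
  exact: sqr_ge0.
rewrite lee_fin ler_pM2r ?invr_gt0 ?exprn_gt0//.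
have := view_cov_sqr_le alpha v p; rewrite -/(noise_var d alpha).
have -> : \sum_(k < d) \sum_(l < d) D k * D l * (n%:R * view_cov alpha p v k l) =
    n%:R * \sum_(k < d) \sum_(l < d) D k * D l * view_cov alpha p v k l.
  rewrite mulr_sumr; apply: eq_bigr => k _; rewrite mulr_sumr.
  by apply: eq_bigr => l _; rewrite mulrCA.
have := view_cov_quad_le alpha v p D; rewrite -/(noise_var d alpha) DE.
set tau := noise_var d alpha; set B := \sum_(k < d) _; set A := \sum_(k < d) _.
move=> Ble Ale; rewrite /dev_bound; apply: lerD; last first.
  have -> : 2 * ((2 / n%:R) ^+ 2 * (n%:R * B)) = 8 / n%:R * B.
    by field; rewrite gt_eqF.
  rewrite [leRHS](_ : _ = 8 / n%:R *
     ((d%:R * norm2 p + tau) * (d%:R * dist2 p p0 ^+ 2))); last by ring.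
  by rewrite ler_wpM2l// divr_ge0// ltW.
have A0 : 0 <= A.
  by apply: sumr_ge0 => k _; apply: sumr_ge0 => l _; exact: sqr_ge0.
have -> : 2 * ((n%:R * (n%:R - 1))^-1 ^+ 2 * (2 * n%:R * (n%:R - 1) * A)) =
    4 * (n%:R * (n%:R - 1))^-1 * A.
  by field; rewrite !gt_eqF.
apply: (@le_trans _ _ (8 / n%:R ^+ 2 * A)); last first.
  rewrite [leRHS](_ : _ = 8 / n%:R ^+ 2 *
    (4 * d%:R ^+ 2 * norm2 p ^+ 2 + 2 * d%:R * tau ^+ 2)); last by ring.
  by rewrite ler_wpM2l// divr_ge0// sqr_ge0.
apply: ler_wpM2r => //.
rewrite ler_pdivrMr ?mulr_gt0// mulrAC ler_pdivlMr ?exprn_gt0//.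
have n2' : 2 <= n%:R :> R by rewrite ler_nat.
nra.
Qed.

(** [144 + 64 v + 1024 v^2] collects the constants of [dev_bound_separated]; the
    factor 4 is the inverse square of the one half in [d D^2 / 2]. *)
Definition rate_const : R := 4 * (144 + 64 * v + 1024 * v ^+ 2).

Lemma rate_const_ge0 : 0 <= rate_const.
Proof.
by rewrite /rate_const; have := noise_var_ge0; have := sqr_ge0 v; lra.
Qed.

Definition separation_const (gamma beta : R) : R :=
  1 + rate_const * (gamma^-1 + beta^-1).

Lemma separation_const_ge1 gamma beta : 0 < gamma -> 0 < beta ->
  1 <= separation_const gamma beta.
Proof.
move=> g0 b0; rewrite /separation_const lerDl.
apply: mulr_ge0; first exact: rate_const_ge0.
by rewrite addr_ge0// invr_ge0 ltW.
Qed.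

(** The three separation requirements in the form in which they enter the variance
    bound. *)
Definition separated (K d n alpha N0 D : R) :=
  [/\ K / n <= D, K * (N0 / n) <= D ^+ 2 &
      K * (Num.sqrt d / (alpha ^+ 2 * n)) <= D ^+ 2].

(** Divided by [d^2], the variance bound is a polynomial in [x = N/n] and
    [y = tau/(d n)].  Separation makes [x] and [sqrt d * y] at most a constant
    times [D^2 / K], hence the bound at most a constant times [D^4 / K]. *)
Lemma dev_bound_separated (K d n alpha N0 N D eps : R) :
  1 <= d -> 0 < n -> 0 < alpha -> 0 <= N -> N <= N0 + D ->
  1 <= K -> 0 < eps -> rate_const <= eps * K ->
  separated K d n alpha N0 D ->
  dev_bound d n (8 * d / alpha ^+ 2 * v) N D <= eps * (d * D ^+ 2 / 2) ^+ 2.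
Proof.
move=> d1 n0 a0 N_ge0 NN0 K1 e0 epsK [h1 h2 h3]; have v0 := noise_var_ge0.
have K0 : 0 < K by exact: lt_le_trans K1.
have d0 : 0 < d by exact: lt_le_trans d1.
have D0 : 0 < D by apply: lt_le_trans h1; rewrite divr_gt0.
pose x := N / n; pose y := 8 * v / alpha ^+ 2 / n; pose g := D ^+ 2 / K.
have g0 : 0 <= g by rewrite divr_ge0 ?sqr_ge0 ?ltW.
have x0 : 0 <= x by rewrite divr_ge0// ltW.
have y0 : 0 <= y by rewrite !divr_ge0 ?mulr_ge0 ?sqr_ge0// ltW.
have xg : x <= 2 * g.
  (* one [g] bounds the part [N0] of [N], the other one the part [D] *)
  have xa : N0 / n <= g by rewrite ler_pdivlMr// mulrC.
  have xb : D / n <= g.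
    by rewrite /g expr2 -mulrA ler_pM2l// ler_pdivlMr// mulrC.
  have : x <= (N0 + D) / n by rewrite ler_pM2r ?invr_gt0.
  by rewrite mulrDl; lra.
have s1 : 1 <= Num.sqrt d by rewrite -[leLHS]sqrtr1 ler_wsqrtr.
have sd : Num.sqrt d ^+ 2 = d by rewrite sqr_sqrtr// ltW.
have syg : Num.sqrt d * y <= 8 * v * g.
  have : Num.sqrt d / (alpha ^+ 2 * n) <= g by rewrite ler_pdivlMr// mulrC.
  rewrite (_ : Num.sqrt d * y = 8 * v * (Num.sqrt d / (alpha ^+ 2 * n))).
    by move=> ?; rewrite ler_wpM2l// mulr_ge0.
  by rewrite /y; field; rewrite !gt_eqF.
have yg : y <= 8 * v * g by apply: le_trans syg; rewrite ler_peMl.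
have dy2 : d * y ^+ 2 <= (8 * v * g) ^+ 2.
  rewrite -{1}sd -exprMn.
  have vg0 : 0 <= 8 * v * g by apply: mulr_ge0 => //; apply: mulr_ge0.
  have sy0 : 0 <= Num.sqrt d * y by apply: mulr_ge0 => //; exact: sqrtr_ge0.
  by rewrite ler_sqr.
have x2 : x ^+ 2 <= (2 * g) ^+ 2.
  by rewrite ler_sqr// nnegrE; apply: mulr_ge0.
have -> : dev_bound d n (8 * d / alpha ^+ 2 * v) N D =
    d ^+ 2 * (32 * x ^+ 2 + 16 * (d * y ^+ 2) + 8 * D ^+ 2 * (x + y)).
  by rewrite /dev_bound /x /y; field; rewrite !gt_eqF.
rewrite [leRHS](_ : _ = d ^+ 2 * (eps * (D ^+ 2) ^+ 2 / 4)); last by field.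
rewrite ler_wpM2l ?sqr_ge0//.
have DK : D ^+ 2 = K * g by rewrite /g mulrC divfK// gt_eqF.
rewrite !DK.
have gK : g ^+ 2 <= K * g ^+ 2 by rewrite ler_peMl ?sqr_ge0.
have step : 32 * x ^+ 2 + 16 * (d * y ^+ 2) + 8 * (K * g) * (x + y) <=
    (144 + 64 * v + 1024 * v ^+ 2) * (K * g ^+ 2).
  have b1 : 32 * x ^+ 2 <= 128 * (K * g ^+ 2).
    by apply: (@le_trans _ _ (128 * g ^+ 2)); [lra|rewrite ler_wpM2l].
  have b2 : 16 * (d * y ^+ 2) <= 1024 * v ^+ 2 * (K * g ^+ 2).
    apply: (@le_trans _ _ (1024 * v ^+ 2 * g ^+ 2)).
      by rewrite (_ : 1024 * v ^+ 2 * g ^+ 2 = 16 * (8 * v * g) ^+ 2);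
        [rewrite ler_wpM2l|ring].
    by apply: ler_wpM2l gK; have := sqr_ge0 v; lra.
  have b3 : 8 * (K * g) * (x + y) <= (16 + 64 * v) * (K * g ^+ 2).
    rewrite (_ : (16 + 64 * v) * (K * g ^+ 2) = 8 * (K * g) * (2 * g + 8 * v * g));
      last by ring.
    apply: ler_wpM2l; last exact: lerD.
    by apply: mulr_ge0 => //; apply: mulr_ge0 => //; exact: ltW.
  lra.
apply: (le_trans step).
rewrite (_ : eps * (K * g) ^+ 2 / 4 = eps * K / 4 * (K * g ^+ 2)); last by ring.
apply: ler_wpM2r; first by rewrite mulr_ge0 ?sqr_ge0// ltW.
by move: epsK; rewrite /rate_const; lra.
Qed.

Lemma noise_varE d (alpha : R) :
  noise_var d alpha = 8 * d%:R / alpha ^+ 2 * v.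
Proof.
rewrite /noise_var /noise_scale; congr (_ * _).
rewrite !exprMn exprVn !sqr_sqrtr//; ring.
Qed.

Lemma dist2xx d (p : pvec R d) : dist2 p p = 0.
Proof.
by rewrite /dist2 /norm2 big1 ?sqrtr0// => k _; rewrite subrr expr0n.
Qed.

Lemma dev_bound_le_D d n tau N D : 0 <= d -> 0 <= n -> 0 <= tau -> 0 <= N ->
  dev_bound d n tau N 0 <= dev_bound d n tau N D.
Proof.
move=> d0 n0 t0 N0; rewrite /dev_bound lerD2l expr0n/= mulr0 mulr0 mul0r.
apply: divr_ge0 => //; rewrite mulr_ge0 ?(mulr_ge0 d0) ?sqr_ge0//.
by apply: mulr_ge0 => //; apply: addr_ge0 => //; exact: mulr_ge0.
Qed.

(** With [c] half of the mean [d delta^2], the deviation bound at [p0] puts the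
    threshold below [c], and the deviation bound at [p] puts the statistic above
    it. *)
Lemma second_kind_error d n (alpha gamma beta : R) (p0 p : pvec R d) :
  0 < gamma < 1 -> 0 < beta -> (1 <= d)%N -> (2 <= n)%N -> 0 < alpha ->
  separated (separation_const gamma beta) d%:R n%:R alpha (norm2 p0) (dist2 p p0) ->
  (private_law alpha p n [set z | Delta alpha gamma p0 z = false] <= beta%:E)%E.
Proof.
move=> /andP[g0 g1] b0 d1 n2 a0 sep; have v0 := noise_var_ge0.
set K := separation_const gamma beta in sep.
have K1 : 1 <= K by exact: separation_const_ge1.
have d1' : 1 <= d%:R :> R by rewrite ler1n.
have n0 : 0 < n%:R :> R by rewrite ltr0n (ltn_trans _ n2).
have D0 : 0 < dist2 p p0.
  by case: sep => h _ _; apply: lt_le_trans h; rewrite divr_gt0// (lt_le_trans _ K1).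
have K0 := rate_const_ge0.
have gK : rate_const <= gamma * K.
  rewrite /K /separation_const mulrDr mulr1 mulrCA mulrDr divff ?gt_eqF//.
  have : 0 <= gamma / beta by rewrite divr_ge0// ltW.
  nra.
have bK : rate_const <= beta * K.
  rewrite /K /separation_const mulrDr mulr1 mulrCA mulrDr divff ?gt_eqF//.
  have : 0 <= beta / gamma by rewrite divr_ge0// ltW.
  nra.
set c := d%:R * dist2 p p0 ^+ 2 / 2.
have c0 : 0 < c by rewrite divr_gt0// mulr_gt0 ?exprn_gt0// (lt_le_trans _ d1').
pose T := That p0 : {RV private_law alpha p0 n >-> R}.
have tc : threshold n alpha gamma p0 <= c.
  apply: quantile_le; first by rewrite subr_gt0 g1 ltrBlDr ltrDl g0.
  have mgt : measurable [set z : n.-tuple (obs R d) | c < That p0 z].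
    rewrite (_ : [set z | _] = ~` [set z | That p0 z <= c]).
      exact: measurableC (measurable_That_le p0 c).
    by apply/seteqP; split => x /=; rewrite ltNge => /negP.
  have -> : cdf T c = (1 - private_law alpha p0 n [set z | (c < That p0 z)%R])%E.
    rewrite -probability_setC//; congr (private_law _ _ _ _).
    by apply/seteqP; split => z /=; rewrite in_itv/= leNgt => /negP.
  rewrite EFinB leeB//.
  apply: (@le_trans _ _ (private_law alpha p0 n
     [set z | (c <= `|That p0 z - d%:R * dist2 p0 p0 ^+ 2|)%R])).
    apply: le_measure; rewrite ?inE//.
      exact: measurable_dev.
    by move=> z /= /ltW cz; rewrite dist2xx expr0n mulr0 subr0 (le_trans cz)// ler_norm.
  apply: (le_trans (That_deviation _ _ _ n2 c0)).
  rewrite lee_fin ler_pdivrMr ?exprn_gt0// dist2xx.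
  apply: (@le_trans _ _ (dev_bound d%:R n%:R (noise_var d alpha) (norm2 p0)
    (dist2 p p0))).
    apply: dev_bound_le_D; rewrite ?norm2_ge0//.
    by rewrite mulr_ge0 ?sqr_ge0.
  rewrite noise_varE; apply: dev_bound_separated sep => //.
    exact: norm2_ge0.
  by rewrite lerDl ltW.
apply: (@le_trans _ _ (private_law alpha p n
    [set z | (c <= `|That p0 z - d%:R * dist2 p p0 ^+ 2|)%R])).
  apply: le_measure; rewrite ?inE//.
  - rewrite (_ : [set z | _] = [set z | That p0 z <= threshold n alpha gamma p0]).
      exact: measurable_That_le.
    by apply/seteqP; split => z /=; rewrite /Delta leNgt; [move/negbT|move/negbTE].
  - exact: measurable_dev.
  move=> z /= /negbT; rewrite -leNgt => /le_trans /(_ tc) Tc.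
  rewrite distrC (le_trans _ (ler_norm _))//.
  by rewrite lerBrDr (le_trans (lerD (lexx c) Tc))// -splitr.
apply: (le_trans (That_deviation _ _ _ n2 c0)).
rewrite lee_fin ler_pdivrMr ?exprn_gt0// noise_varE.
apply: dev_bound_separated sep => //; first exact: norm2_ge0.
exact: norm2_triangle.
Qed.

End power.

(** * Comparison of separation rates *)

Section rates.
Context {R : realType}.
Implicit Types K d n alpha D : R.

(** The square roots of the rates are what the theorem is stated with; squaring
    loses nothing because [K <= K^2]. *)
Lemma separated_sqrt K d n alpha N0 D s a b : 1 <= K -> 0 < alpha -> 0 < s ->
  0 <= a -> 0 <= b -> s ^+ 2 = n -> a ^+ 2 = Num.sqrt d -> N0 <= b ^+ 2 ->
  K / n <= D -> K * (b / s) <= D -> K * (a / (alpha * s)) <= D ->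
  separated K d n alpha N0 D.
Proof.
move=> K1 al0 s0 a0 b0 sn ad Nb h1 h2 h3.
have K0 : 0 <= K by exact: le_trans K1.
have sqrt_le z : 0 <= z -> K * z <= D -> K * z ^+ 2 <= D ^+ 2.
  move=> z0 KzD; apply: (@le_trans _ _ ((K * z) ^+ 2)).
    by rewrite exprMn ler_wpM2r ?sqr_ge0// expr2 ler_peMl.
  by rewrite ler_sqr ?nnegrE ?mulr_ge0// (le_trans _ KzD)// mulr_ge0.
split => //.
  apply: le_trans (sqrt_le _ _ h2); last by rewrite divr_ge0// ltW.
  by rewrite expr_div_n sn ler_wpM2l// ler_wpM2r// -sn invr_ge0 sqr_ge0.
apply: le_trans (sqrt_le _ _ h3); last by rewrite divr_ge0// mulr_ge0// ltW.
by rewrite expr_div_n exprMn sn ad.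
Qed.

Lemma powR_half x : 0 <= x -> (x `^ 2^-1) ^+ 2 = x :> R.
Proof. by move=> x0; rewrite powR12_sqrt// sqr_sqrtr. Qed.

Lemma powR_quarter x : 0 <= x -> (x `^ 4^-1) ^+ 2 = Num.sqrt x :> R.
Proof.
move=> x0; rewrite -powR_mulrn ?powR_ge0// -powRrM -powR12_sqrt//.
by congr (_ `^ _); field.
Qed.

(** After cancelling the powers of [d], the left-hand side is the sum of the three
    rates, each of which is therefore below [D]. *)
Lemma separated_local_rate K (d n : nat) alpha S D :
  1 <= K -> (1 <= d)%N -> (2 <= n)%N -> 0 < alpha -> 0 <= S ->
  K * (d%:R `^ (- 4^-1) / n%:R `^ 2^-1) *
    (d%:R `^ 4^-1 * (S `^ 4^-1 + n%:R `^ (- 2^-1)) + d%:R `^ 2^-1 * alpha^-1)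
    <= D ->
  separated K d%:R n%:R alpha (Num.sqrt S) D.
Proof.
move=> K1 d1 n2 al0 S0; rewrite !powRN.
have d0 : 0 < d%:R :> R by rewrite ltr0n.
have n0 : 0 < n%:R :> R by rewrite ltr0n (ltn_trans _ n2).
set a := d%:R `^ 4^-1; set s := n%:R `^ 2^-1; set b := S `^ 4^-1.
have a0 : 0 < a by rewrite powR_gt0.
have s0 : 0 < s by rewrite powR_gt0.
have b0 : 0 <= b by exact: powR_ge0.
have sn : s ^+ 2 = n%:R by apply: powR_half; exact: ltW.
have ad : a ^+ 2 = Num.sqrt d%:R by apply: powR_quarter; exact: ltW.
have -> : d%:R `^ 2^-1 = a ^+ 2 by rewrite powR12_sqrt ?ltW.
have -> : K * (a^-1 / s) * (a * (b + s^-1) + a ^+ 2 * alpha^-1) =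
    K * (b / s) + K / n%:R + K * (a / (alpha * s)).
  by rewrite -sn; field; rewrite !gt_eqF.
have K0 : 0 <= K by exact: le_trans K1.
have t1 : 0 <= K * (b / s) by rewrite mulr_ge0// divr_ge0// ltW.
have t2 : 0 <= K / n%:R by rewrite divr_ge0.
have t3 : 0 <= K * (a / (alpha * s)).
  by rewrite mulr_ge0// divr_ge0// ?mulr_ge0// ltW.
move=> h; apply: (@separated_sqrt _ _ _ _ _ _ s a b) => //; try exact: ltW; try lra.
by rewrite powR_quarter.
Qed.

(** Here [1/n <= 1/sqrt n] and [N0 <= 1], so the bounds by [K / n] and by
    [K * N0 / n] both follow from [K / sqrt n <= D]. *)
Lemma separated_uniform_rate K (d n : nat) alpha N0 D :
  1 <= K -> (1 <= d)%N -> (2 <= n)%N -> 0 < alpha -> N0 <= 1 ->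
  K * n%:R `^ (- 2^-1) * Num.max 1 (d%:R `^ 4^-1 * alpha^-1) <= D ->
  separated K d%:R n%:R alpha N0 D.
Proof.
move=> K1 d1 n2 al0 N1; rewrite powRN.
have d0 : 0 < d%:R :> R by rewrite ltr0n.
have n0 : 0 < n%:R :> R by rewrite ltr0n (ltn_trans _ n2).
set a := d%:R `^ 4^-1; set s := n%:R `^ 2^-1 => h.
have a0 : 0 < a by rewrite powR_gt0.
have s0 : 0 < s by rewrite powR_gt0.
have sn : s ^+ 2 = n%:R by apply: powR_half; exact: ltW.
have ad : a ^+ 2 = Num.sqrt d%:R by apply: powR_quarter; exact: ltW.
have s1 : 1 <= s.
  have : 1 <= s ^+ 2 by rewrite sn ler1n (leq_trans _ n2).
  by rewrite expr_ge1// ltW.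
have Ks0 : 0 <= K / s by rewrite divr_ge0 ?(le_trans _ K1)// ltW.
have h1 : K / s <= D.
  by apply: le_trans h; rewrite ler_peMr// le_max lexx.
have h2 : K * (a / (alpha * s)) <= D.
  apply: le_trans h; apply: (@le_trans _ _ (K / s * (a / alpha))).
    by rewrite invfM; lra.
  by rewrite ler_wpM2l// le_max lexx orbT.
apply: (@separated_sqrt _ _ _ _ _ _ s a 1) => //; try exact: ltW.
- by rewrite expr1n.
- apply: le_trans h1; rewrite -sn expr2 invfM mulrA ler_piMr//.
  by rewrite invf_le1.
- by rewrite mul1r.
Qed.

End rates.

Theorem theorem4p5 (R : realType) (gamma beta : R) :
  0 < gamma < 1 -> 0 < beta < 1 ->
  [/\ forall (d n : nat) (alpha : R) (p0 : pvec R d),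
        (1 <= d)%N -> (2 <= n)%N -> 0 < alpha ->
        private_law alpha p0 n
          [set z | Delta alpha gamma p0 z = true] = gamma%:E,
      exists C : R, 0 < C /\
        forall (d n : nat) (alpha : R) (p0 p : pvec R d),
        (1 <= d)%N -> (2 <= n)%N -> 0 < alpha ->
        C * (d%:R `^ (- 4^-1) / n%:R `^ 2^-1) *
          (d%:R `^ 4^-1 *
             ((\sum_(k < d) p0 k ^+ 2) `^ 4^-1 + n%:R `^ (- 2^-1)) +
           d%:R `^ 2^-1 * alpha^-1)
          <= Num.sqrt (\sum_(i < d) (p i - p0 i) ^+ 2) ->
        (private_law alpha p n
          [set z | Delta alpha gamma p0 z = false] <= beta%:E)%E
    & exists C : R, 0 < C /\
        forall (d n : nat) (alpha : R) (p0 p : pvec R d),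
        (1 <= d)%N -> (2 <= n)%N -> 0 < alpha ->
        C * n%:R `^ (- 2^-1) * Num.max 1 (d%:R `^ 4^-1 * alpha^-1)
          <= Num.sqrt (\sum_(i < d) (p i - p0 i) ^+ 2) ->
        (private_law alpha p n
          [set z | Delta alpha gamma p0 z = false] <= beta%:E)%E].
Proof.
move=> g01 /andP[b0 _]; have [v vP] := @laplace_sqr R.
have [g0 _] := andP g01.
have K1 := separation_const_ge1 vP g0 b0.
have K0 := lt_le_trans ltr01 K1.
split.
- by move=> d n alpha p0; exact: first_kind_error.
- exists (separation_const v gamma beta); split => // d n alpha p0 p d1 n2 a0 h.
  apply: (second_kind_error vP) => //; apply: separated_local_rate h => //.
  by apply: sumr_ge0 => k _; exact: sqr_ge0.
- exists (separation_const v gamma beta); split => // d n alpha p0 p d1 n2 a0 h.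
  apply: (second_kind_error vP) => //; apply: separated_uniform_rate h => //.
  exact: norm2_le1.
Qed.
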